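(* Every simple torsion free $\mathfrak{sl}(2)$-module has finite rank, so the set of isomorphism classes of simple torsion free $\mathfrak{sl}(2)$-modules equals the set of isomorphism classes of simple torsion free finite rank $\mathfrak{sl}(2)$-modules. The rationalization functor $F_{\mathrm{rat}}$ induces a bijection from this set onto the set of isomorphism classes of $\mathcal{RC}$-simple objects of $\mathcal{RC}$, and the latter set equals the set of isomorphism classes of $\mathcal R$-simple objects of $\mathcal R$ (in particular every $\mathcal R$-simple rational module is a Casimir module).
   Context: $\mathfrak{sl}(2)$ has basis $L_{-1}=f$, $L_0=-\tfrac12 h$, $L_1=-e$ for a Chevalley basis $e,f,h$. Every $\mathfrak{sl}(2)$-module $(V,\rho)$ is a $\mathbb{C}[z]$-module via $z\cdot v=\rho(L_0)v$; it is torsion free if it is torsion free as a $\mathbb{C}[z]$-module, and of finite rank if $S^{-1}V$ is a finite-dimensional $\mathbb{C}(z)$-vector space, where $S=\mathbb{C}[z]\setminus\{0\}$. Casimir operator: $C_\rho=\rho(L_0)(\rho(L_0)-1)-\rho(L_{-1})\rho(L_1)$; $V$ is Casimir if $C_\rho=\mu\,\mathrm{Id}$ for some $\mu\in\mathbb{C}$. A rational module is an $\mathfrak{sl}(2)$-module which, with its $\mathbb{C}[z]$-structure, is a finite-dimensional $\mathbb{C}(z)$-vector space; $\mathcal R$ is the full subcategory of rational modules and $\mathcal{RC}$ the full subcategory of rational Casimir modules. An object of $\mathcal R$ (resp. $\mathcal{RC}$) is $\mathcal R$-simple (resp. $\mathcal{RC}$-simple) if it is nonzero and has no nonzero proper subobject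 in $\mathcal R$ (resp. $\mathcal{RC}$), i.e. no nonzero proper $\mathfrak{sl}(2)$-submodule that is a $\mathbb{C}(z)$-subspace (and Casimir). The rationalization functor sends a torsion free finite rank $(V,\rho)$ to $F_{\mathrm{rat}}(V,\rho)=(S^{-1}V,\rho_{\mathrm{rat}})$ with $\rho_{\mathrm{rat}}(L_{-1})(v/p(z))=\rho(L_{-1})(v)/p(z-1)$, $\rho_{\mathrm{rat}}(L_0)(v/p(z))=z v/p(z)$, $\rho_{\mathrm{rat}}(L_1)(v/p(z))=\rho(L_1)(v)/p(z+1)$. *)

(* Defs.v *)
From HB Require Import structures.
From mathcomp Require Import all_boot all_order all_algebra.
From mathcomp Require Import reals.
From mathcomp Require Export complex.
Set Implicit Arguments. Unset Strict Implicit. Unset Printing Implicit Defensive.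
Import Order.TTheory GRing.Theory Num.Theory.
Local Open Scope ring_scope.

Section Sl2Defs.
Variable C : fieldType.

Definition ratfun := {fraction {poly C}}.
Definition frc (p : {poly C}) : ratfun := FracField.tofrac p.

(* bracket relations [L_m, L_n] = (m - n) L_{m+n} for m,n in {-1,0,1},
   a = L_{-1}, b = L_0, c = L_1 *)
Definition sl2_brackets (V : zmodType) (a b c : V -> V) :=
  [/\ forall v, c (a v) - a (c v) = b v *+ 2,
      forall v, b (c v) - c (b v) = - c v &
      forall v, b (a v) - a (b v) = a v].

Definition Clinear (V W : lmodType C) (f : V -> W) :=
  forall (k : C) (u w : V), f (k *: u + w) = k *: f u + f w.

Record sl2mod (V : lmodType C) := Sl2Mod {
  Lm1 : V -> V; L0 : V -> V; L1 : V -> V;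
  Lm1_lin : Clinear Lm1; L0_lin : Clinear L0; L1_lin : Clinear L1;
  sl2_rel : sl2_brackets Lm1 L0 L1 }.

Definition pact (V : lmodType C) (f : V -> V) (p : {poly C}) (v : V) : V :=
  \sum_(i < size p) p`_i *: iter i f v.

Section Modules.
Variables (V : lmodType C) (rho : sl2mod V).

Definition torsion_free :=
  forall (p : {poly C}) (v : V), p != 0 -> pact (L0 rho) p v = 0 -> v = 0.

(* S^{-1} V is finite dimensional over C(z): it is spanned by finitely many
   v/1, i.e. (clearing denominators) some nonzero multiple of every vector
   lies in the C[z]-span of a finite family *)
Definition finite_rank :=
  exists s : seq V, forall v : V, exists2 p : {poly C}, p != 0 &
    exists c : 'I_(size s) -> {poly C},
      pact (L0 rho) p v = \sum_(i < size s) pact (L0 rho) (c i) s`_i.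

Definition submodule (P : V -> Prop) :=
  [/\ P 0, (forall u w, P u -> P w -> P (u + w)),
      (forall (k : C) u, P u -> P (k *: u)) &
      [/\ forall u, P u -> P (Lm1 rho u), forall u, P u -> P (L0 rho u)
        & forall u, P u -> P (L1 rho u)]].

Definition simple_mod :=
  (exists v : V, v != 0) /\
  forall P : V -> Prop, submodule P -> (exists2 v, P v & v != 0) -> forall v, P v.
End Modules.

Definition sl2_iso (V W : lmodType C) (rho : sl2mod V) (sigma : sl2mod W) :=
  exists f : V -> W, [/\ Clinear f, bijective f &
    [/\ forall v, f (Lm1 rho v) = Lm1 sigma (f v),
        forall v, f (L0 rho v) = L0 sigma (f v) &
        forall v, f (L1 rho v) = L1 sigma (f v)]].

(* Rational modules: an sl(2)-module M whose C[z]-module structure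
   (z acting by rho(L_0)) is a finite-dimensional C(z)-vector space.
   M carries its C(z)-vector space structure; the C-structure is the
   restriction of scalars along C -> C(z). *)
Definition cscale (M : lmodType ratfun) (k : C) (m : M) : M := frc k%:P *: m.

Definition Clinear_rat (M N : lmodType ratfun) (f : M -> N) :=
  forall (k : C) (u w : M), f (cscale k u + w) = cscale k (f u) + f w.

Record ratmod (M : lmodType ratfun) := RatMod {
  Qm1 : M -> M; Q0 : M -> M; Q1 : M -> M;
  Qm1_lin : Clinear_rat Qm1; Q0_lin : Clinear_rat Q0; Q1_lin : Clinear_rat Q1;
  rat_rel : sl2_brackets Qm1 Q0 Q1;
  Q0_z : forall m, Q0 m = frc 'X *: m;
  rat_fin : exists s : seq M, forall m : M, exists c : 'I_(size s) -> ratfun,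
      m = \sum_(i < size s) c i *: s`_i }.

Section RatModules.
Variables (M : lmodType ratfun) (rho : ratmod M).

Definition casimir_op (m : M) : M := Q0 rho (Q0 rho m - m) - Qm1 rho (Q1 rho m).

Definition casimir := exists mu : C, forall m, casimir_op m = cscale mu m.

Definition rat_subobject (P : M -> Prop) :=
  [/\ P 0, (forall u w, P u -> P w -> P (u + w)),
      (forall (k : ratfun) u, P u -> P (k *: u)) &
      [/\ forall u, P u -> P (Qm1 rho u), forall u, P u -> P (Q0 rho u)
        & forall u, P u -> P (Q1 rho u)]].

Definition R_simple :=
  (exists m : M, m != 0) /\
  forall P : M -> Prop, rat_subobject P -> (exists2 m, P m & m != 0) -> forall m, P m.

Definition RC_simple :=
  casimir /\ (exists m : M, m != 0) /\
  forall P : M -> Prop, rat_subobject P ->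
    (exists mu : C, forall m, P m -> casimir_op m = cscale mu m) ->
    (exists2 m, P m & m != 0) -> forall m, P m.
End RatModules.

Definition rat_iso (M N : lmodType ratfun) (rho : ratmod M) (sigma : ratmod N) :=
  exists f : M -> N, [/\ Clinear_rat f, bijective f &
    [/\ forall m, f (Qm1 rho m) = Qm1 sigma (f m),
        forall m, f (Q0 rho m) = Q0 sigma (f m) &
        forall m, f (Q1 rho m) = Q1 sigma (f m)]].

(* (M, sigma) together with iota : V -> M is the rationalization
   F_rat(V, rho) = (S^{-1} V, rho_rat): iota is the C[z]-linear localization
   map v |-> v/1 (kernel = S-torsion, every element is v/p(z)), and rho_rat is
   given by the formulas of the paper. *)
Definition rationalization (V : lmodType C) (rho : sl2mod V)
    (M : lmodType ratfun) (sigma : ratmod M) (iota : V -> M) :=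
  [/\ forall (k : C) (u w : V), iota (k *: u + w) = cscale k (iota u) + iota w,
      forall v, iota (L0 rho v) = frc 'X *: iota v,
      forall v, iota v = 0 <-> exists2 p : {poly C}, p != 0 & pact (L0 rho) p v = 0,
      forall m : M, exists v : V, exists2 p : {poly C}, p != 0 &
                                     m = (frc p)^-1 *: iota v &
      forall (v : V) (p : {poly C}), p != 0 ->
      [/\ Qm1 sigma ((frc p)^-1 *: iota v) =
            (frc (p \Po ('X - 1)))^-1 *: iota (Lm1 rho v),
          Q0 sigma ((frc p)^-1 *: iota v) = frc 'X *: ((frc p)^-1 *: iota v) &
          Q1 sigma ((frc p)^-1 *: iota v) =
            (frc (p \Po ('X + 1)))^-1 *: iota (L1 rho v)]].

End Sl2Defs.

(* Main.v *)
Require Import Defs.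
From HB Require Import structures.
From mathcomp Require Import all_boot all_order all_algebra.
From mathcomp Require Import boolp classical_sets cardinality.
From mathcomp Require Import ereal measure lebesgue_measure.
From mathcomp Require Import reals complex.
Set Implicit Arguments. Unset Strict Implicit. Unset Printing Implicit Defensive.
Import Order.TTheory GRing.Theory Num.Theory.
Local Open Scope ring_scope.

(* Write a = L_{-1}, c = L_1 and let z act by L_0, so that a p(z) = p(z-1) a,
   c p(z) = p(z+1) c, and the Casimir operator theta satisfies
   a c = z(z-1) - theta, c a = z(z+1) - theta.

   On a simple module theta is a scalar mu (Dixmier: the ground field is
   uncountable, the module has countable dimension).  The vectors which a power
   of a sends into sum_j C[z] a^j (z v) form a submodule; as it contains v, the
   vectors a^j v are dependent over C[z], and a shortest relation between them
   has nonzero extreme coefficients, whence finite rank.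

   On a rational module, theta satisfies a polynomial equation P(z, theta) = 0.
   Differencing in z shows that q(theta) kills a^k M for some q in C[t]; without
   an eigenvalue in C, both a and c would be nilpotent, which is absurd.  So an
   R-simple module is Casimir.

   For surjectivity one needs a simple sl(2)-submodule inside an RC-simple N.
   Fix n0 <> 0.  A relation p n0 = sum_{i>0} p_i a^i n0 over C[z], and a similar
   one for c, propagate membership of n0 in the localizations of a
   submodule P along z-orbits, upwards for a and downwards for c.  Since P has
   n0 locally at almost all points, this yields a vector w = q(z) n0, with q
   independent of P, lying in every nonzero submodule; the intersection of all
   nonzero submodules is then nonzero and simple. *)

(** * Linear dependence and endomorphisms as polynomial actions *)

Lemma span_dependent (K : fieldType) (V : lmodType K) (n : nat) (e : 'I_n -> V)
    (x : 'I_n.+1 -> V) :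
  (forall i, exists c : 'I_n -> K, x i = \sum_k c k *: e k) ->
  exists2 d : 'I_n.+1 -> K, exists i, d i != 0 & \sum_i d i *: x i = 0.
Proof.
move=> xs; pose c i := projT1 (cid (xs i)).
pose A := \matrix_(i < n.+1, j < n) c i j.
have : kermx A != 0.
  by rewrite kermx_eq0 /row_free neq_ltn ltnS rank_leq_col.
move: (kermx A) (mulmx_ker A) => B BA /matrix0Pn[r [i nzi]].
exists (B r); first by exists i.
under eq_bigr => k _ do rewrite {1}(projT2 (cid (xs k))) scaler_sumr.
rewrite exchange_big big1 //= => j _.
under eq_bigr => k _ do rewrite scalerA.
rewrite -scaler_suml.
have /matrixP/(_ r j) := BA; rewrite !mxE => BAj.
rewrite -[RHS](scale0r (e j)) -[in RHS]BAj; congr (_ *: _).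
by apply: eq_bigr => k _; rewrite mxE.
Qed.

Section PolyAction.
Variables (K : comNzRingType) (V : lmodType K) (f : {linear V -> V}).

Definition polyact (p : {poly K}) (v : V) : V := \sum_(i < size p) p`_i *: iter i f v.

Lemma polyactE (p : {poly K}) (n : nat) (v : V) : (size p <= n)%N ->
  polyact p v = \sum_(i < n) p`_i *: iter i f v.
Proof.
move=> le_pn; rewrite /polyact (big_ord_widen _ (fun i => p`_i *: iter i f v) le_pn).
rewrite [RHS](bigID (fun i : 'I_n => (i < size p)%N)) /= [X in _ + X]big1 ?addr0 //.
by move=> i; rewrite -leqNgt => /(nth_default 0)->; rewrite scale0r.
Qed.

Lemma polyactDl (v : V) : {morph polyact^~ v : p q / p + q}.
Proof.
move=> p q; set n := maxn (size p) (size q).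
rewrite (@polyactE (p + q) n) ?(leq_trans (size_polyD _ _)) //.
rewrite (@polyactE p n) ?leq_maxl // (@polyactE q n) ?leq_maxr // -big_split /=.
by apply: eq_bigr => i _; rewrite coefD scalerDl.
Qed.

Lemma polyact_linear (p : {poly K}) : linear (polyact p).
Proof.
have itl (i : nat) : linear (iter i f).
  by elim: i => [|i IH] k u v //=; rewrite IH linearP.
move=> k u v; rewrite /polyact scaler_sumr -big_split /=; apply: eq_bigr => i _.
by rewrite itl scalerDr !scalerA mulrC.
Qed.

Lemma polyactC (c : K) (v : V) : polyact c%:P v = c *: v.
Proof. by rewrite (@polyactE _ 1) ?size_polyC_leq1 // big_ord1 coefC. Qed.

Lemma polyactMX (p : {poly K}) (v : V) : polyact (p * 'X) v = polyact p (f v).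
Proof.
rewrite (@polyactE _ (size p).+1) ?(leq_trans (size_polyMleq _ _)) ?size_polyX ?addn2 //.
rewrite big_ord_recl coefMX scale0r add0r /polyact; apply: eq_bigr => i _.
by rewrite coefMX /= -iterSr.
Qed.

Lemma polyactXM (p : {poly K}) (v : V) : polyact (p * 'X) v = f (polyact p v).
Proof.
rewrite polyactMX /polyact linear_sum; apply: eq_bigr => i _ /=.
by rewrite linearZ /= -iterSr.
Qed.

Lemma polyactM (p q : {poly K}) (v : V) : polyact p (polyact q v) = polyact (p * q) v.
Proof.
elim/poly_ind: p v => [|p c IH] v; first by rewrite mul0r /polyact size_poly0 !big_ord0.
rewrite mulrDl !polyactDl polyactC polyactMX -polyactXM polyactMX IH -polyactMX mulrAC.
congr (_ + _); rewrite mul_polyC (@polyactE (c *: q) (size q)) ?size_scale_leq // /polyact.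
by rewrite scaler_sumr; apply: eq_bigr => i _; rewrite coefZ scalerA.
Qed.

Definition polymod of {linear V -> V} : Type := V.
HB.instance Definition _ := GRing.Zmodule.on (polymod f).

Fact polymod_scale1 : left_id 1 polyact.
Proof. by move=> v; rewrite -[1]/(1%:P) polyactC scale1r. Qed.

Fact polymod_scaleDr : right_distributive polyact +%R.
Proof. by move=> p u v; have := polyact_linear p 1 u v; rewrite !scale1r. Qed.

HB.instance Definition _ := GRing.Zmodule_isLmodule.Build {poly K} (polymod f)
  polyactM polymod_scale1 polymod_scaleDr polyactDl.

Lemma polymodE (p : {poly K}) (v : polymod f) : p *: v = polyact p v.
Proof. by []. Qed.

Lemma polymodX (v : polymod f) : 'X *: v = f v.
Proof. by rewrite polymodE -['X]mul1r polyactXM -[1]/(1%:P) polyactC scale1r. Qed.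

Lemma polymodC (c : K) (v : polymod f) : c%:P *: v = c *: (v : V).
Proof. exact: polyactC. Qed.
End PolyAction.

Arguments polymodE {K V} f p v.
Arguments polymodX {K V} f v.
Arguments polymodC {K V} f c v.

(** Over a closed field [q] splits into linear factors, and each [f - mu] is injective. *)
Lemma polymod_torsion_free (K : closedFieldType) (V : lmodType K) (f : {linear V -> V}) :
  (forall mu x, f x = mu *: x -> x = 0) ->
  forall (q : {poly K}) (w : polymod f), q != 0 -> q *: w = 0 -> w = 0.
Proof.
move=> inj q w; have [r ->] := closed_field_poly_normal q.
rewrite -mul_polyC mulf_eq0 negb_or polyC_eq0 => /andP[nzq _].
rewrite -scalerA polymodC => /eqP; rewrite scaler_eq0 (negPf nzq) => /eqP.
elim: r => [|z r IH]; first by rewrite big_nil => <-; rewrite scale1r.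
rewrite big_cons -scalerA scalerBl polymodX polymodC => /eqP.
by rewrite subr_eq0 => /eqP/inj/IH.
Qed.

(** * Restriction of scalars and submodules as types *)

Section RestrictScalars.
Variables (R S : nzRingType) (phi : {rmorphism R -> S}) (M : lmodType S).

Definition resmod of {rmorphism R -> S} : Type := M.
HB.instance Definition _ := GRing.Zmodule.on (resmod phi).

Definition resmod_scale (r : R) (m : M) : M := phi r *: m.

Fact resmod_scaleA r s m : resmod_scale r (resmod_scale s m) = resmod_scale (r * s) m.
Proof. by rewrite /resmod_scale scalerA rmorphM. Qed.
Fact resmod_scale1 : left_id 1 resmod_scale.
Proof. by move=> m; rewrite /resmod_scale rmorph1 scale1r. Qed.
Fact resmod_scaleDr : right_distributive resmod_scale +%R.
Proof. by move=> r u v; rewrite /resmod_scale scalerDr. Qed.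
Fact resmod_scaleDl m : {morph resmod_scale^~ m : r s / r + s}.
Proof. by move=> r s; rewrite /resmod_scale rmorphD scalerDl. Qed.

HB.instance Definition _ := GRing.Zmodule_isLmodule.Build R (resmod phi)
  resmod_scaleA resmod_scale1 resmod_scaleDr resmod_scaleDl.
End RestrictScalars.

Section SubspaceModule.
Variables (R : nzRingType) (M : lmodType R) (P : M -> Prop).
Hypotheses (P0 : P 0) (PP : forall a u v, P u -> P v -> P (a *: u + v)).

Definition subspace_pred : {pred M} := fun m => `[< P m >].

Fact subspace_closed : subsemimod_closed subspace_pred.
Proof.
have P2 a u v : P u -> P v -> P (a *: u + v) by exact: PP.
split; first split.
- exact/asboolP.
- by move=> u v /asboolP Pu /asboolP Pv; apply/asboolP; rewrite -[u]scale1r; exact: P2.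
- by move=> a u /asboolP Pu; apply/asboolP; rewrite -[_ *: _]addr0; exact: P2.
Qed.

Record subspace : Type := Subspace {subspace_val : M; _ : subspace_val \in subspace_pred}.
HB.instance Definition _ := [isSub for subspace_val].
HB.instance Definition _ := [Choice of subspace by <:].
HB.instance Definition _ :=
  GRing.SubChoice_isSubLmodule.Build R M subspace_pred subspace subspace_closed.

(** Lets the simple submodule found inside a rational module become a module in its own right, known
    only through its embedding. *)
Lemma subspace_lmod : exists (V : lmodType R) (j : V -> M),
  [/\ forall a u v, j (a *: u + v) = a *: j u + j v, injective j &
      forall m, P m <-> exists v, j v = m].
Proof.
exists subspace, subspace_val; split.
- by move=> a u v; rewrite -[subspace_val]/(val : subspace -> M) linearP.
- exact: val_inj.
- move=> m; split=> [Pm|[[v Pv] <-]]; last exact/asboolP.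
  have Pm' : m \in subspace_pred by apply/asboolP.
  by exists (Subspace Pm').
Qed.
End SubspaceModule.

(** * Schur's lemma in countable dimension *)

Section Sl2Linear.
Variables (C : fieldType) (V : lmodType C) (rho : sl2mod V).
HB.instance Definition _ := GRing.isLinear.Build C V V *:%R (Lm1 rho) (Lm1_lin rho).
HB.instance Definition _ := GRing.isLinear.Build C V V *:%R (L0 rho) (L0_lin rho).
HB.instance Definition _ := GRing.isLinear.Build C V V *:%R (L1 rho) (L1_lin rho).
End Sl2Linear.

Section CasimirScalar.
Variables (C : numClosedFieldType) (V : lmodType C) (rho : sl2mod V).
Hypotheses (Cuncount : ~ countable [set: C]) (simpleV : simple_mod rho).
Variable f : {linear V -> V}.
Hypotheses (fa : forall v, f (Lm1 rho v) = Lm1 rho (f v))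
  (fb : forall v, f (L0 rho v) = L0 rho (f v))
  (fc : forall v, f (L1 rho v) = L1 rho (f v)).

Definition word_op (i : 'I_3) : V -> V :=
  if i == 0 then Lm1 rho else if i == 1 then L0 rho else L1 rho.

(** Monomials in the three operators applied to [v], enumerated through [unpickle]; a number that
    codes no word gives 0. On a simple module with [v] nonzero, this is a countable spanning
    family. *)
Definition word_vec (v : V) (k : nat) : V :=
  if unpickle k is Some w then foldr word_op v (w : seq 'I_3) else 0.

Definition in_span (e : nat -> V) (n : nat) (x : V) :=
  exists c : nat -> C, x = \sum_(k < n) c k *: e k.

Lemma words_span (v : V) : v != 0 -> forall x, exists n, in_span (word_vec v) n x.
Proof.
move=> nzv; pose U x := exists n, in_span (word_vec v) n x; have [_ simpl] := simpleV.
have widen n m (c : nat -> C) : (n <= m)%N -> \sum_(k < n) c k *: word_vec v k =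
    \sum_(k < m) (if (k < n)%N then c k else 0) *: word_vec v k.
  move=> lenm; rewrite (big_ord_widen _ (fun k => c k *: word_vec v k) lenm).
  rewrite big_mkcond; apply: eq_bigr => i _.
  by case: ifP => //; rewrite scale0r.
have U0 : U 0 by exists 0, (fun=> 0); rewrite big_ord0.
have UD x y : U x -> U y -> U (x + y).
  move=> [n [c ->]] [m [d ->]]; exists (maxn n m).
  rewrite (widen _ _ c (leq_maxl n m)) (widen _ _ d (leq_maxr n m)).
  exists (fun k => (if (k < n)%N then c k else 0) + (if (k < m)%N then d k else 0)).
  by rewrite -big_split; apply: eq_bigr => i _; rewrite scalerDl.
have UZ k x : U x -> U (k *: x).
  move=> [n [c ->]]; exists n, (fun i => k * c i).
  by rewrite scaler_sumr; apply: eq_bigr => i _; rewrite scalerA.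
have Ue k : U (word_vec v k).
  exists k.+1, (fun i => (i == k)%:R).
  rewrite big_ord_recr big1 /= ?eqxx ?scale1r ?add0r // => i _.
  by rewrite (ltn_eqF (ltn_ord i)) scale0r.
have Uw i (g : {linear V -> V}) : (forall x, g x = word_op i x) ->
    forall x, U x -> U (g x).
  move=> gE x [n [c ->]]; rewrite linear_sum; apply: big_ind => // k _.
  rewrite linearZ; apply: (UZ); rewrite /word_vec.
  case: unpickle => [w|]; last by rewrite linear0.
  by rewrite gE -/(foldr word_op v (i :: w)); have := Ue (pickle (i :: w));
     rewrite /word_vec pickleK.
apply: simpl; last first.
  by exists v => //; have := Ue (pickle ([::] : seq 'I_3)); rewrite /word_vec pickleK.
split=> //; split.
- exact: (Uw 0 (Lm1 rho)).
- exact: (Uw 1 (L0 rho)).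
- exact: (Uw 2 (L1 rho)).
Qed.

Lemma eigen_all (mu : C) (x : V) : x != 0 -> f x = mu *: x -> forall v, f v = mu *: v.
Proof.
move=> nzx fx; have [_ simpl] := simpleV.
apply: (simpl (fun v => f v = mu *: v)); last by exists x.
split; first by rewrite linear0 scaler0.
- by move=> u w fu fw; rewrite linearD fu fw scalerDr.
- by move=> k u fu; rewrite linearZ /= fu !scalerA mulrC.
by split=> u fu; rewrite (fa, fb, fc) fu linearZ.
Qed.

(** The image of [f - mu] is a submodule because [f] commutes with the action, and it is nonzero by
    injectivity. *)
Lemma resolvent_surj (mu : C) (v : V) : (forall x, f x = mu *: x -> x = 0) ->
  exists x, f x - mu *: x = v.
Proof.
move=> inj; have [[y nzy] simpl] := simpleV.
apply: (simpl (fun v => exists x, f x - mu *: x = v)); last first.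
  exists (f y - mu *: y); first by exists y.
  by apply: contra_neq nzy => /eqP; rewrite subr_eq0 => /eqP /inj.
split.
- by exists 0; rewrite linear0 scaler0 subrr.
- by move=> _ _ [u <-] [w <-]; exists (u + w); rewrite linearD scalerDr opprD addrACA.
- move=> k _ [u <-]; exists (k *: u).
  by rewrite linearZ /= scalerBr !scalerA mulrC.
split=> _ [u <-].
- by exists (Lm1 rho u); rewrite fa [RHS]linearB /= [Lm1 rho (_ *: _)]linearZ.
- by exists (L0 rho u); rewrite fb [RHS]linearB /= [L0 rho (_ *: _)]linearZ.
- by exists (L1 rho u); rewrite fc [RHS]linearB /= [L1 rho (_ *: _)]linearZ.
Qed.

(* Dixmier's form of Schur's lemma: if [f] had no eigenvalue, the resolvents
   [(f - mu)^-1 v] would be uncountably many independent vectors in a space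
   of countable dimension. *)
Theorem commuting_scalar : exists mu : C, forall v, f v = mu *: v.
Proof.
apply: contrapT => nomu; have [[v nzv] _] := simpleV.
have inj mu x : f x = mu *: x -> x = 0.
  move=> fx; apply/eqP; apply: contra_notT nomu => nzx.
  by exists mu; exact: eigen_all nzx fx.
have res mu : exists x, f x - mu *: x = v by apply: resolvent_surj; exact: inj.
pose x mu := projT1 (cid (res mu)).
have xE mu : f (x mu) - mu *: x mu = v by exact: projT2 (cid (res mu)).
have pinj (q : {poly C}) (w : polymod f) : q != 0 -> q *: w = 0 -> w = 0.
  exact: polymod_torsion_free.
have indep m (mu : 'I_m -> C) (d : 'I_m -> C) : injective mu ->
    \sum_i d i *: x (mu i) = 0 -> forall i, d i = 0.
  move=> muinj d0 i.
  (* Applying all factors [f - mu j] to the relation turns it into [q(f) v = 0]; at [mu i] only the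
     [i]-th summand of [q] survives. *)
  pose q := \sum_i d i *: \prod_(j | j != i) ('X - (mu j)%:P).
  have q0 : q = 0.
    apply/eqP; apply: contraTT isT => nzq.
    suff /(pinj _ _ nzq)/eqP : q *: (v : polymod f) = 0 by rewrite (negPf nzv).
    have : (\prod_j ('X - (mu j)%:P)) *: (\sum_i d i *: x (mu i) : polymod f) = 0.
      by rewrite d0 scaler0.
    rewrite scaler_sumr => sum0; rewrite scaler_suml -[RHS]sum0.
    apply: eq_bigr => k _; rewrite -(polymodC f) scalerA [in RHS](bigD1 k) //=.
    have <- : ('X - (mu k)%:P) *: (x (mu k) : polymod f) = v.
      by rewrite scalerBl polymodX polymodC.
    rewrite scalerA -mul_polyC; congr (_ *: _).
    by rewrite -mulrA [RHS]mulrC; congr (_ * _); rewrite mulrC.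
  have s0 := congr1 (horner^~ (mu i)) q0; rewrite /= horner0 horner_sum in s0.
  have : (d i *: \prod_(j | j != i) ('X - (mu j)%:P)).[mu i] = 0.
    rewrite -[RHS]s0 [RHS](bigD1 i) //= [X in _ = _ + X]big1 ?addr0 // => k nki.
    rewrite hornerZ horner_prod (bigD1 i) ?(eq_sym i) //=.
    by rewrite hornerXsubC subrr mul0r mulr0.
  rewrite hornerZ horner_prod => /eqP; rewrite mulf_eq0 => /orP[/eqP //|].
  case/prodf_eq0 => j nji; rewrite hornerXsubC subr_eq0 => /eqP/muinj ij.
  by rewrite ij eqxx in nji.
(* The first [n] words span a space of dimension at most [n], which contains at most [n] of the
   independent vectors [x mu]. *)
have fin n : finite_set [set mu | in_span (word_vec v) n (x mu)].
  apply: contrapT => /(infinite_set_fset n.+1)[B sB cB].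
  pose mu (i : 'I_n.+1) : C := nth 0 (finmap.enum_fset B) i.
  have lt (i : 'I_n.+1) : (i < size (finmap.enum_fset B))%N by apply: leq_trans cB.
  have muinj : injective mu.
    move=> i j /eqP; rewrite nth_uniq ?finmap.fset_uniq // => /eqP; exact: val_inj.
  have [i|d [i /eqP nzdi] d0] := @span_dependent _ _ n (word_vec v \o val) (x \o mu).
    have [c xc] : in_span (word_vec v) n (x (mu i)) by apply: sB; rewrite /= mem_nth.
    by exists (c \o val).
  by case: nzdi; exact: (indep _ _ _ muinj d0).
apply: Cuncount.
have -> : [set: C]%classic = (\bigcup_(n in setT) [set mu | in_span (word_vec v) n (x mu)])%classic.
  by apply/seteqP; split=> // mu _; have [n ?] := words_span nzv (x mu); exists n.
by apply: bigcup_countable => // n _; exact: finite_set_countable.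
Qed.
End CasimirScalar.

(** * Common denominators and translations of polynomials *)

Section Fractions.
Variable R : idomainType.
Local Notation tofrac := (@FracField.tofrac R).

Lemma fraction_numden (x : {fraction R}) :
  exists n, exists2 d, d != 0 & tofrac d * x = tofrac n.
Proof.
elim/quotW: x => r; exists (frac r).1; exists (frac r).2; first exact: denom_ratioP.
unlock FracField.tofrac; rewrite -[LHS]FracField.pi_mul.
apply/eqmodP => /=; rewrite /FracField.equivf /= /FracField.mulf.
by rewrite !numden_Ratio ?mul1r ?oner_neq0 ?mulr1 ?denom_ratioP.
Qed.

Lemma common_denominator (n : nat) (x : 'I_n -> {fraction R}) :
  exists2 d, d != 0 & exists c : 'I_n -> R, forall i, tofrac d * x i = tofrac (c i).
Proof.
have nd i : exists nd : R * R, nd.2 != 0 /\ tofrac nd.2 * x i = tofrac nd.1.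
  by have [p [q nzq E]] := fraction_numden (x i); exists (p, q).
pose u i := projT1 (cid (nd i)).
have uP i : (u i).2 != 0 /\ tofrac (u i).2 * x i = tofrac (u i).1.
  exact: projT2 (cid (nd i)).
exists (\prod_i (u i).2); first by apply/prodf_neq0 => i _; case: (uP i).
exists (fun i => (\prod_(j | j != i) (u j).2) * (u i).1) => i.
rewrite [in RHS]tofracM; case: (uP i) => _ <-.
by rewrite (bigD1 i) //= tofracM -mulrA mulrCA.
Qed.
End Fractions.

Section Shift.
Variable C : numFieldType.
Implicit Types (p q : {poly C}) (s t : C).

Definition shift s : {poly C} -> {poly C} := comp_poly ('X - s%:P).
HB.instance Definition _ s := GRing.RMorphism.on (shift s).

Lemma shiftX s : shift s 'X = 'X - s%:P. Proof. exact: comp_polyX. Qed.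

Lemma shiftC s c : shift s c%:P = c%:P. Proof. exact: comp_polyC. Qed.

Lemma shiftD s t p : shift s (shift t p) = shift (s + t) p.
Proof.
rewrite /shift -comp_polyA; congr (_ \Po _).
by rewrite comp_polyB comp_polyX comp_polyC polyCD opprD addrA.
Qed.

Lemma shift0 p : shift 0 p = p. Proof. by rewrite /shift subr0 comp_polyXr. Qed.

Lemma shiftK s : cancel (shift s) (shift (- s)).
Proof. by move=> p; rewrite shiftD addNr shift0. Qed.

Lemma shiftNK s : cancel (shift (- s)) (shift s).
Proof. by move=> p; rewrite shiftD subrr shift0. Qed.

Lemma shift_eq0 s p : (shift s p == 0) = (p == 0).
Proof. by rewrite comp_poly2_eq0 // size_XsubC. Qed.

Lemma horner_shift s p x : (shift s p).[x] = p.[x - s].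
Proof. by rewrite horner_comp hornerXsubC. Qed.

(** By periodicity [p] takes its value at 0 at all points [-s n], infinitely many in characteristic
    0. *)
Lemma shift_invariant p s : s != 0 -> shift s p = p -> p = (p`_0)%:P.
Proof.
move=> nzs sp; apply/eqP; rewrite -subr_eq0; apply: contraT => nz.
have root n : root (p - (p`_0)%:P) (- (s *+ n)).
  rewrite /root !hornerE -horner_coef0 subr_eq0; apply/eqP.
  elim: n => [|n <-]; first by rewrite mulr0n oppr0.
  by rewrite -[in RHS]sp horner_shift mulrSr opprD.
have := max_poly_roots nz (rs := [seq - (s *+ n) | n <- iota 0 (size (p - (p`_0)%:P))]).
rewrite size_map size_iota ltnn => bad; apply: bad.
  by apply/allP => _ /mapP[n _ ->].
by rewrite map_inj_uniq ?iota_uniq // => i j /oppr_inj/(mulrIn nzs).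
Qed.
End Shift.

(** * Semilinear operators and relations between their iterates *)

Section Semilinear.
Variables (C : numFieldType) (V : lmodType {poly C}) (s : C) (T : V -> V).
Hypotheses (TD : {morph T : u v / u + v}) (TZ : forall p v, T (p *: v) = shift s p *: T v).

Lemma semilin0 : T 0 = 0.
Proof. by apply: (addrI (T 0)); rewrite -TD !addr0. Qed.

Lemma semilin_sum (I : Type) (r : seq I) (P : pred I) (F : I -> V) :
  T (\sum_(i <- r | P i) F i) = \sum_(i <- r | P i) T (F i).
Proof. by apply: big_morph => //; exact: semilin0. Qed.

Lemma semilin_iterZ i p v : iter i T (p *: v) = shift (s *+ i) p *: iter i T v.
Proof.
elim: i => [|i IH] /=; first by rewrite mulr0n shift0.
by rewrite IH TZ shiftD mulrS.
Qed.

Lemma semilin_iterD i : {morph iter i T : u v / u + v}.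
Proof. by elim: i => // i IH u v /=; rewrite IH TD. Qed.

Definition rel_sum (n : nat) (c : nat -> {poly C}) (v : V) := \sum_(i < n) c i *: iter i T v.

(** In a shortest relation the top coefficient is nonzero. If the constant one vanished, the
    relation would be the image under the injective [T] of a shorter one, with coefficients shifted
    back. *)
Lemma minimal_relation (v : V) : (forall x, T x = 0 -> x = 0) ->
  (exists n c, rel_sum n c v = 0 /\ exists2 i, (i < n)%N & c i != 0) ->
  exists h c, [/\ rel_sum h.+1 c v = 0, c 0 != 0, c h != 0 &
    forall d, rel_sum h d v = 0 -> forall i, (i < h)%N -> d i = 0].
Proof.
move=> Tinj ex.
pose A n := exists c, rel_sum n c v = 0 /\ exists2 i, (i < n)%N & c i != 0.
have exA : exists n, `[< A n >] by have [n [c H]] := ex; exists n; apply/asboolP; exists c.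
case: (ex_minnP exA) => -[|h] /asboolP[c [c0 [i ltin nzi]]] minh //.
have indep d : rel_sum h d v = 0 -> forall i, (i < h)%N -> d i = 0.
  move=> d0 j ltjh; apply/eqP; apply: contraT => nzj.
  suff : (h < h)%N by rewrite ltnn.
  by apply: minh; apply/asboolP; exists d; split=> //; exists j.
have nzh : c h != 0.
  apply: contraNN nzi => /eqP ch0; have [->|neih] := eqVneq i h; first exact/eqP.
  apply/eqP; apply: indep; last by rewrite ltn_neqAle neih.
  by move: c0; rewrite /rel_sum big_ord_recr /= ch0 scale0r addr0.
exists h, c; split=> //; apply: contraNN nzh => /eqP c00.
case: h => [|h] in minh indep ltin c0 *; first exact/eqP.
have : rel_sum h.+1 (fun i => shift (- s) (c i.+1)) v = 0.
  apply: Tinj; rewrite -[RHS]c0 /rel_sum [RHS]big_ord_recl /= c00 scale0r add0r semilin_sum.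
  by apply: eq_bigr => j _; rewrite TZ shiftNK.
by move/indep/(_ h (ltnSn _))/eqP; rewrite shift_eq0.
Qed.
End Semilinear.

Section SemilinearExtension.
Variables (C : numFieldType) (V V' : lmodType {poly C}) (s : C) (T : V -> V').
Hypotheses (TD : {morph T : u v / u + v})
  (TC : forall k v, T (k%:P *: v) = k%:P *: T v)
  (TX : forall v, T ('X *: v) = ('X - s%:P) *: T v).

(** The brackets with [L_0] only give the commutation rule with [z]; induction on [p] extends it to
    all polynomials. *)
Lemma semilinear_from_X p v : T (p *: v) = shift s p *: T v.
Proof.
elim/poly_ind: p v => [|p k IH] v.
  by rewrite rmorph0 !scale0r; apply: (addrI (T 0)); rewrite -TD !addr0.
rewrite scalerDl TD TC -scalerA IH TX scalerA -scalerDl; congr (_ *: _).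
by rewrite rmorphD rmorphM /= shiftC shiftX.
Qed.
End SemilinearExtension.

Lemma linear_from_X (C : numFieldType) (V V' : lmodType {poly C}) (f : V -> V') :
  {morph f : u v / u + v} -> (forall k v, f (k%:P *: v) = k%:P *: f v) ->
  (forall v, f ('X *: v) = 'X *: f v) -> forall p v, f (p *: v) = p *: f v.
Proof.
move=> fD fC fX p v; rewrite -{2}(shift0 p); apply: semilinear_from_X => // u.
by rewrite subr0.
Qed.

(** * The Casimir operator over C[z] *)

Section Sl2Semilinear.
Variables (C : numFieldType) (W : lmodType {poly C}) (a c : W -> W).

(** Common form of [sl2mod] and [ratmod]: the brackets with [L_0] become the two twisted linearity
    rules, and the bracket of [L_1] with [L_{-1}] stays as an equation. *)
Definition sl2_semilinear :=
  [/\ {morph a : u v / u + v}, {morph c : u v / u + v},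
      forall p v, a (p *: v) = shift 1 p *: a v,
      forall p v, c (p *: v) = shift (-1) p *: c v &
      forall v, c (a v) - a (c v) = 'X *: v *+ 2].

Definition cas (v : W) := 'X *: ('X *: v - v) - a (c v).

Definition zstable (P : W -> Prop) :=
  [/\ P 0, forall u v, P u -> P v -> P (u + v), forall p u, P u -> P (p *: u),
      forall u, P u -> P (a u) & forall u, P u -> P (c u)].

Definition ztorsion_free := forall (p : {poly C}) (v : W), p *: v = 0 -> p = 0 \/ v = 0.

Definition zsimple :=
  forall P : W -> Prop, zstable P -> (exists2 v, P v & v != 0) -> forall v, P v.

Hypothesis ac : sl2_semilinear.

Let aD : {morph a : u v / u + v}. Proof. by case: ac. Qed.
Let cD : {morph c : u v / u + v}. Proof. by case: ac. Qed.
Let aZ p v : a (p *: v) = shift 1 p *: a v. Proof. by case: ac. Qed.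
Let cZ p v : c (p *: v) = shift (-1) p *: c v. Proof. by case: ac. Qed.
Let aN v : a (- v) = - a v. Proof. by rewrite -scaleN1r aZ rmorphN1 scaleN1r. Qed.
Let cN v : c (- v) = - c v. Proof. by rewrite -scaleN1r cZ rmorphN1 scaleN1r. Qed.

Lemma casE v : cas v = ('X * ('X - 1)) *: v - a (c v).
Proof. by rewrite /cas -scalerA scalerBl scale1r. Qed.

Lemma cas_ac v : a (c v) = ('X * ('X - 1)) *: v - cas v.
Proof. by rewrite casE subKr. Qed.

Lemma cas_ca v : c (a v) = ('X * ('X + 1)) *: v - cas v.
Proof.
have [_ _ _ _ /(_ v)/eqP] := ac; rewrite subr_eq => /eqP->.
rewrite cas_ac addrA -scaler_nat scalerA -scalerDl.
congr (_ *: _ - _); rewrite mulrBr mulr1 mulrDr mulr1.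
by rewrite mulr2n mulrDl mul1r addrC addrA subrK.
Qed.

Lemma casD : {morph cas : u v / u + v}.
Proof. by move=> u v; rewrite !casE cD aD scalerDr opprD addrACA. Qed.

Lemma casZ p v : cas (p *: v) = p *: cas v.
Proof.
by rewrite !casE cZ aZ shiftD subrr shift0 scalerBr !scalerA [p * _]mulrC.
Qed.

(** Expand [a (c (a v))] in two ways, by [cas_ac] at [a v] and by [cas_ca] at [v]. *)
Lemma cas_a v : cas (a v) = a (cas v).
Proof.
apply: oppr_inj; apply: (addrI (('X * ('X - 1)) *: a v)); rewrite -cas_ac cas_ca aD aN aZ.
by rewrite rmorphM rmorphD /= shiftX [shift 1 1]rmorph1 polyC1 subrK mulrC.
Qed.

Lemma cas_c v : cas (c v) = c (cas v).
Proof.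
apply: oppr_inj; apply: (addrI (('X * ('X + 1)) *: c v)); rewrite -cas_ca cas_ac cD cN cZ.
by rewrite rmorphM rmorphB /= shiftX [shift _ 1]rmorph1 polyCN polyC1 opprK addrK mulrC.
Qed.

(** * Finite rank when the Casimir operator is scalar *)

Section ScalarCasimir.
Variable mu : C.
Hypotheses (casmu : forall v, cas v = mu%:P *: v) (tf : ztorsion_free).

Lemma quadratic_neq0 (x y : C) : ('X + x%:P) * ('X + y%:P) - mu%:P != 0.
Proof.
apply: contraTneq (size_polyC_leq1 mu) => /eqP; rewrite subr_eq0 => /eqP<-.
by rewrite size_mul -?size_poly_eq0 !size_XaddC.
Qed.

Lemma cas_ac_scalar v : a (c v) = ('X * ('X - 1) - mu%:P) *: v.
Proof. by rewrite cas_ac casmu scalerBl. Qed.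

Lemma cas_ca_scalar v : c (a v) = ('X * ('X + 1) - mu%:P) *: v.
Proof. by rewrite cas_ca casmu scalerBl. Qed.

(** [c a] multiplies by the nonzero polynomial [z(z+1) - mu], and the module is torsion free. *)
Lemma a_inj x : a x = 0 -> x = 0.
Proof.
move=> ax; have := cas_ca_scalar x; rewrite ax.
have -> : c 0 = 0 by apply: (addrI (c 0)); rewrite -cD !addr0.
move/esym/tf => [/eqP|//]; have := quadratic_neq0 0 1.
by rewrite addr0 polyC1 => /negPf->.
Qed.

Lemma c_inj x : c x = 0 -> x = 0.
Proof.
move=> cx; have := cas_ac_scalar x; rewrite cx.
have -> : a 0 = 0 by apply: (addrI (a 0)); rewrite -aD !addr0.
move/esym/tf => [/eqP|//]; have := quadratic_neq0 0 (-1).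
by rewrite addr0 polyCN polyC1 => /negPf->.
Qed.

Hypothesis simpleW : zsimple.

(* The vectors some power of [a] sends into [sum_j C[z] a^j (z v)] form a
   submodule; it contains [v], and the resulting relation is nontrivial
   because its coefficient at [a^k v] takes the value [-1] at [z = k]. *)
Lemma simple_relation v : v != 0 ->
  exists n d, rel_sum a n d v = 0 /\ exists2 i, (i < n)%N & d i != 0.
Proof.
move=> nzv; pose L w := exists n d, w = rel_sum a n d ('X *: v).
have iZ := semilin_iterZ aZ.
have widen n m (d : nat -> {poly C}) u : (n <= m)%N -> rel_sum a n d u =
    rel_sum a m (fun i => if (i < n)%N then d i else 0) u.
  move=> lenm; rewrite /rel_sum (big_ord_widen _ (fun i => d i *: iter i a u) lenm).
  by rewrite big_mkcond; apply: eq_bigr => i _; case: ifP => //; rewrite scale0r.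
have LD u w : L u -> L w -> L (u + w).
  move=> [n [d ->]] [m [e ->]]; exists (maxn n m).
  rewrite (widen _ _ d _ (leq_maxl n m)) (widen _ _ e _ (leq_maxr n m)).
  exists (fun i => (if (i < n)%N then d i else 0) + (if (i < m)%N then e i else 0)).
  by rewrite /rel_sum -big_split; apply: eq_bigr => i _; rewrite scalerDl.
have LZ p u : L u -> L (p *: u).
  move=> [n [d ->]]; exists n, (fun i => p * d i).
  by rewrite /rel_sum scaler_sumr; apply: eq_bigr => i _; rewrite scalerA.
have La u : L u -> L (a u).
  move=> [n [d ->]]; exists n.+1, (fun i => shift 1 (d i.-1) *+ (i != 0)%N).
  rewrite /rel_sum (semilin_sum aD) big_ord_recl mulr0n scale0r add0r.
  by apply: eq_bigr => i _; rewrite aZ.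
have Lak k u : L u -> L (iter k a u) by elim: k => //= k IH /IH/La.
pose P w := exists k, L (iter k a w).
have [k [n [d dE]]] : P v.
  apply: (simpleW (P := P)); last first.
    exists ('X *: v); last first.
      by apply: contra_neq nzv => /tf[/eqP|//]; rewrite polyX_eq0.
    by exists 0%N, 1%N, (fun=> 1); rewrite /rel_sum big_ord1 scale1r.
  split.
  - exists 0%N, 0%N, (fun=> 0); by rewrite /rel_sum big_ord0.
  - move=> u w [k Lu] [l Lw]; exists (k + l)%N; rewrite (semilin_iterD aD).
    by apply: LD; [rewrite addnC|]; rewrite iterD; exact: Lak.
  - by move=> p u [k Lu]; exists k; rewrite iZ; exact: LZ.
  - by move=> u [k Lu]; exists k; rewrite -iterSr; exact: La.
  (* [a^(k+1) c u = a^k (a c) u], and [a c] multiplies by a polynomial. *)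
  - move=> u [k Lu]; exists k.+1; rewrite iterSr cas_ac_scalar iZ; exact: LZ.
(* Moving [z] across [a^i] turns it into [z - i], so [a^k v] is the sum of the [d i (z - i) a^i v];
   [e] brings both sides together. *)
pose e i := (if (i < n)%N then d i * ('X - i%:R%:P) else 0) - (i == k)%:R.
exists (maxn n k.+1), e; split; last first.
  exists k; first exact: leq_maxr.
  apply: contraTneq isT => /(congr1 (horner^~ k%:R)); rewrite /e eqxx horner0.
  rewrite !hornerE; case: ifP => _; rewrite ?hornerM ?hornerXsubC ?subrr ?mulr0 ?horner0.
    by rewrite sub0r => /eqP; rewrite oppr_eq0 oner_eq0.
  by rewrite sub0r => /eqP; rewrite oppr_eq0 oner_eq0.
rewrite /rel_sum; under eq_bigr => i _ do rewrite scalerBl.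
rewrite sumrB.
have -> : \sum_(i < maxn n k.+1) (i == k :> nat)%:R *: iter i a v = iter k a v.
  have ltk : (k < maxn n k.+1)%N by exact: leq_maxr.
  rewrite (bigD1 (Ordinal ltk)) //= eqxx scale1r big1 ?addr0 // => i nik.
  by rewrite -(inj_eq val_inj) /= in nik; rewrite (negPf nik) scale0r.
rewrite dE (widen _ _ d _ (leq_maxl n k.+1)) /rel_sum -sumrB big1 // => i _.
case: ifP => _; last by rewrite !scale0r subrr.
by rewrite iZ shiftX scalerA subrr.
Qed.

(* A minimal relation has nonzero constant term, so the [C(z)]-span of
   [v, ..., a^(h-1) v] is stable under division by [a], hence under [c]. *)
Lemma simple_free_rank : (exists v : W, v != 0) ->
  exists h (e : 'I_h -> W),
    (forall d : 'I_h -> {poly C}, \sum_i d i *: e i = 0 -> forall i, d i = 0) /\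
    forall w, exists2 p, p != 0 & exists d : 'I_h -> {poly C}, p *: w = \sum_i d i *: e i.
Proof.
move=> [v nzv].
have [h [q [q0 nzq0 nzqh indep]]] := minimal_relation aD aZ a_inj (simple_relation nzv).
exists h, (fun i => iter i a v); split.
  move=> d d0 i; pose d' k := if insub k is Some j then d j else 0.
  have := indep d' _ i (ltn_ord i); rewrite /d' valK; apply.
  by rewrite -[RHS]d0; apply: eq_bigr => j _; rewrite /d' valK.
pose S w := exists d, w = rel_sum a h d v.
pose P w := exists2 p : {poly C}, p != 0 & S (p *: w).
have S0 : S 0 by exists (fun=> 0); rewrite /rel_sum big1 // => i _; rewrite scale0r.
have SD u w : S u -> S w -> S (u + w).
  move=> [d ->] [e ->]; exists (fun i => d i + e i).
  by rewrite /rel_sum -big_split; apply: eq_bigr => i _; rewrite scalerDl.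
have SZ p u : S u -> S (p *: u).
  move=> [d ->]; exists (fun i => p * d i).
  by rewrite /rel_sum scaler_sumr; apply: eq_bigr => i _; rewrite scalerA.
have Sind (Q : W -> Prop) : Q 0 -> (forall u w, Q u -> Q w -> Q (u + w)) ->
    (forall p u, Q u -> Q (p *: u)) -> (forall i, (i < h)%N -> Q (iter i a v)) ->
    forall u, S u -> Q u.
  by move=> Q0 QD QZ Qi _ [d ->]; apply: big_ind => // i _; apply/QZ/Qi.
have Si i : (i < h)%N -> S (iter i a v).
  move=> ltih; exists (fun k => (k == i)%:R).
  rewrite /rel_sum (bigD1 (Ordinal ltih)) //= eqxx scale1r big1 ?addr0 // => k nki.
  by rewrite -(inj_eq val_inj) /= in nki; rewrite (negPf nki) scale0r.
have Stop : S (q h *: iter h a v).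
  move: q0; rewrite /rel_sum big_ord_recr /= addrC => /eqP; rewrite addr_eq0 => /eqP->.
  by exists (fun i => - q i); rewrite -sumrN; apply: eq_bigr => i _; rewrite scaleNr.
have Sa u : S u -> S (q h *: a u).
  apply: (Sind (fun u => S (q h *: a u))) => [|x y Sx Sy|p x Sx|i ltih];
    rewrite ?(semilin0 aD) ?scaler0 //.
  - by rewrite aD scalerDr; exact: SD.
  - by rewrite aZ scalerA mulrC -scalerA; exact: SZ.
  - rewrite -iterS; have [ltih1|] := ltnP i.+1 h; first exact/SZ/Si.
    by move=> leh; have -> : i.+1 = h by apply/eqP; rewrite eqn_leq ltih leh.
(* Up to the factor [q 0], the span [S] lies in [a S]: for the vector [v] itself this is the
   relation solved for its constant term. *)
have Sdiv0 u : S u -> exists2 y, S y & q 0 *: u = a y.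
  apply: (Sind (fun u => exists2 y, S y & q 0 *: u = a y))
    => [|x y [x' Sx' Ex] [y' Sy' Ey]|p x [x' Sx' Ex]|[|i] ltih].
  - by exists 0; rewrite // (semilin0 aD) scaler0.
  - by exists (x' + y'); [exact: SD | rewrite aD scalerDr Ex Ey].
  - exists (shift (-1) p *: x'); first exact: SZ.
    by rewrite aZ shiftNK scalerA mulrC -scalerA Ex.
  - exists (rel_sum a h (fun i => - shift (-1) (q i.+1)) v); first by eexists.
    move: q0; rewrite /rel_sum big_ord_recl => /eqP; rewrite addr_eq0 => /eqP->.
    rewrite (semilin_sum aD) -sumrN; apply: eq_bigr => i _.
    by rewrite aZ rmorphN /= shiftNK scaleNr.
  - exists (shift (-1) (q 0) *: iter i a v); first by apply/SZ/Si; exact: ltnW.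
    by rewrite aZ shiftNK.
have Sdiv u : P (a u) -> P u.
  move=> [p nzp /Sdiv0[y Sy Ey]]; exists (shift (-1) (q 0 * p)).
    by rewrite shift_eq0 mulf_neq0.
  suff -> : shift (-1) (q 0 * p) *: u = y by [].
  by apply/eqP; rewrite -subr_eq0; apply/eqP/a_inj; rewrite aD aN aZ shiftNK -scalerA Ey subrr.
have PZ p u : P u -> P (p *: u).
  move=> [r nzr Sr]; exists r => //.
  by rewrite scalerA mulrC -scalerA; exact: SZ.
suff PW w : P w by move=> w; have [p nzp [d pw]] := PW w; exists p => //; exists (d \o val).
apply: (simpleW (P := P)); last first.
  exists v => //; have [lt0h|] := ltnP 0 h.
    by exists 1; rewrite ?oner_neq0 // scale1r; exact: (Si 0).
  rewrite leqn0 => /eqP h0; exists (q h) => //.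
  by have := Stop; rewrite [iter h _ _](_ : _ = v) // h0.
split=> //.
- by exists 1; rewrite ?oner_neq0 // scaler0.
- move=> u y [p nzp Sp] [r nzr Sr]; exists (p * r); first by rewrite mulf_neq0.
  rewrite scalerDr; apply: SD; last by rewrite -scalerA; exact: SZ.
  by rewrite mulrC -scalerA; exact: SZ.
- move=> u [p nzp Sp]; exists (q h * shift 1 p); first by rewrite mulf_neq0 ?shift_eq0.
  by rewrite -scalerA -aZ; exact: Sa.
(* [a (c u)] is a multiple of [u], so [c u] is reached by dividing by [a]. *)
- by move=> u Pu; apply: Sdiv; rewrite cas_ac_scalar; exact: PZ.
Qed.
End ScalarCasimir.
End Sl2Semilinear.

(** * Finite families, and rational modules over C[z] *)

Section FiniteFamilies.
Variables (R : nzRingType) (V : lmodType R) (h : nat) (e : 'I_h -> V).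

(** Finite rank and [rat_fin] list generators in a sequence, while the arguments produce families
    indexed by ['I_h]. *)
Lemma sum_seq_of_ord (d : 'I_h -> R) :
  exists c : 'I_(size [seq e i | i <- enum 'I_h]) -> R,
    \sum_i d i *: e i = \sum_i c i *: [seq e i | i <- enum 'I_h]`_i.
Proof.
have sz : size [seq e i | i <- enum 'I_h] = h by rewrite size_map size_enum_ord.
exists (fun i => d (cast_ord sz i)).
rewrite (reindex (cast_ord sz)); last first.
  by exists (cast_ord (esym sz)) => i _; rewrite (cast_ordK, cast_ordKV).
apply: eq_bigr => i _; congr (_ *: _).
have lti : (i < h)%N := ltn_ord (cast_ord sz i).
rewrite (nth_map (Ordinal lti)) ?size_enum_ord //; congr (e _).
by apply: val_inj; rewrite /= nth_enum_ord.
Qed.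
End FiniteFamilies.

Section RatSemilinear.
Variables (C : numFieldType) (M : lmodType (ratfun C)) (sigma : ratmod M).

Definition zrat : lmodType {poly C} := resmod M (@FracField.tofrac {poly C}).

Lemma zratE p (m : zrat) : p *: m = frc p *: (m : M). Proof. by []. Qed.

Lemma frc_eq0 (p : {poly C}) : (frc p == 0) = (p == 0). Proof. exact: tofrac_eq0. Qed.

Lemma Clinear_ratD (N : lmodType (ratfun C)) (f : M -> N) :
  Clinear_rat f -> {morph f : u v / u + v}.
Proof.
move=> fl u v; have := fl 1 u v; rewrite /cscale polyC1 /frc tofrac1 !scale1r.
by [].
Qed.

Lemma Clinear_rat0 (N : lmodType (ratfun C)) (f : M -> N) : Clinear_rat f -> f 0 = 0.
Proof. by move=> /Clinear_ratD fD; apply: (addrI (f 0)); rewrite -fD !addr0. Qed.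

Lemma Clinear_ratZ (N : lmodType (ratfun C)) (f : M -> N) : Clinear_rat f ->
  forall k u, f (frc k%:P *: u) = frc k%:P *: f u.
Proof.
by move=> fl k u; have := fl k u 0; rewrite !addr0 (Clinear_rat0 fl) addr0.
Qed.

Lemma ratmod_semilinear : sl2_semilinear (W := zrat) (Qm1 sigma) (Q1 sigma).
Proof.
have [r1 r2 r3] := rat_rel sigma.
have aD := Clinear_ratD (Qm1_lin sigma); have cD := Clinear_ratD (Q1_lin sigma).
split=> //.
- apply: semilinear_from_X => //; first exact: (Clinear_ratZ (Qm1_lin sigma)).
  move=> v; rewrite scalerBl polyC1 scale1r !zratE -!(Q0_z sigma).
  by apply/eqP; rewrite eq_sym subr_eq addrC -subr_eq r3.
- apply: semilinear_from_X => //; first exact: (Clinear_ratZ (Q1_lin sigma)).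
  move=> v; rewrite scalerBl polyCN polyC1 scaleN1r opprK !zratE -!(Q0_z sigma).
  by have /eqP := r2 v; rewrite subr_eq addrC => /eqP->; rewrite subrK.
- by move=> v; rewrite zratE -(Q0_z sigma); exact: r1.
Qed.

Lemma casimir_opE m : casimir_op sigma m = cas (W := zrat) (Qm1 sigma) (Q1 sigma) m.
Proof. by rewrite /casimir_op !(Q0_z sigma). Qed.

Lemma zrat_torsion_free : ztorsion_free zrat.
Proof.
move=> p v /eqP; rewrite zratE scaler_eq0 frc_eq0 => /orP[]/eqP; by [left|right].
Qed.
End RatSemilinear.

Lemma scale_common_denominator (F : fieldType) (L : lmodType F) (x y : F) (u v : L) :
  x != 0 -> y != 0 -> (x * y)^-1 *: (y *: u + x *: v) = x^-1 *: u + y^-1 *: v.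
Proof.
move=> nzx nzy; rewrite invfM scalerDr !scalerA divfK //.
by rewrite mulrAC mulVf // mul1r.
Qed.

(** * Localization at the nonzero polynomials *)

Section Localization.
Variable C : numFieldType.

(** The torsion free case of S^{-1}W: the condition on the kernel of [iota] becomes injectivity. *)
Definition localization (W : lmodType {poly C}) (M : lmodType (ratfun C)) (iota : W -> M) :=
  [/\ {morph iota : u v / u + v}, forall p v, iota (p *: v) = frc p *: iota v,
      forall v, iota v = 0 -> v = 0 &
      forall m : M, exists v p, p != 0 /\ m = (frc p)^-1 *: iota v].

Lemma localization_exists (W : lmodType {poly C}) h (e : 'I_h -> W) :
  ztorsion_free W ->
  (forall d : 'I_h -> {poly C}, \sum_i d i *: e i = 0 -> forall i, d i = 0) ->
  (forall w, exists2 p, p != 0 & exists d : 'I_h -> {poly C}, p *: w = \sum_i d i *: e i) ->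
  exists iota : W -> 'rV[ratfun C]_h, localization iota.
Proof.
move=> tf indep span.
have spanT w : exists pd : {poly C} * ('I_h -> {poly C}),
    pd.1 != 0 /\ pd.1 *: w = \sum_i pd.2 i *: e i.
  by have [p nzp [d E]] := span w; exists (p, d).
pose pd w := projT1 (cid (spanT w)).
have pdP w : (pd w).1 != 0 /\ (pd w).1 *: w = \sum_i (pd w).2 i *: e i.
  exact: projT2 (cid (spanT w)).
pose iota w : 'rV[ratfun C]_h := \row_i (frc ((pd w).2 i) / frc (pd w).1).
(* By independence the coordinates in [C(z)] are the same for every multiple of [w] in the span of
   [e], so additivity and linearity can be checked on a convenient one. *)
have key w p d : p != 0 -> p *: w = \sum_i d i *: e i ->
    iota w = \row_i (frc (d i) / frc p).
  move=> nzp E; have [nzq Eq] := pdP w; apply/rowP => i; rewrite !mxE.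
  apply/eqP; rewrite eqr_div ?frc_eq0 // -!tofracM tofrac_eq; apply/eqP.
  apply/eqP; rewrite -subr_eq0; apply/eqP.
  apply: (indep (fun i => (pd w).2 i * p - d i * (pd w).1)).
  under eq_bigr => j _ do rewrite scalerBl [_ * p]mulrC [d j * _]mulrC -!scalerA.
  by rewrite sumrB -!scaler_sumr -Eq -E !scalerA mulrC subrr.
exists iota; split.
- move=> u v; have [nzp Eu] := pdP u; have [nzq Ev] := pdP v.
  rewrite (key (u + v) ((pd u).1 * (pd v).1)
    (fun i => (pd u).2 i * (pd v).1 + (pd v).2 i * (pd u).1)) ?mulf_neq0 //.
    apply/rowP => i; rewrite !mxE addf_div ?frc_eq0 //.
    by rewrite /frc tofracD !tofracM.
  rewrite scalerDr [_ * (pd v).1]mulrC -[in LHS]scalerA Eu mulrC -scalerA Ev.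
  rewrite !scaler_sumr -big_split; apply: eq_bigr => i _.
  by rewrite scalerDl !scalerA [(pd u).2 i * _]mulrC [(pd v).2 i * _]mulrC.
- move=> p v; have [nzq Ev] := pdP v.
  rewrite (key (p *: v) (pd v).1 (fun i => p * (pd v).2 i)) //.
    by apply/rowP => i; rewrite !mxE /frc tofracM mulrA.
  by rewrite scalerA mulrC -scalerA Ev scaler_sumr; apply: eq_bigr => i _; rewrite scalerA.
- move=> v /rowP v0; have [nzq Ev] := pdP v.
  have d0 i : (pd v).2 i = 0.
    have /eqP := v0 i; rewrite !mxE mulf_eq0 invr_eq0 !frc_eq0 (negPf nzq) orbF.
    by move/eqP.
  move: Ev; rewrite big1 => [|i _]; last by rewrite d0 scale0r.
  by case/tf => // /eqP; rewrite (negPf nzq).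
- move=> m; have [d nzd [c cE]] := common_denominator (fun i => m 0 i).
  exists (\sum_i c i *: e i), d; split=> //.
  rewrite (key _ 1 c) ?oner_neq0 ?scale1r //; apply/rowP => i; rewrite !mxE.
  by rewrite /frc tofrac1 divr1 -cE mulrA mulVf ?mul1r // tofrac_eq0.
Qed.

Variables (W W' : lmodType {poly C}) (M M' : lmodType (ratfun C)).
Variables (iota : W -> M) (iota' : W' -> M') (tau : {rmorphism {poly C} -> {poly C}}).
Variable f : W -> W'.
Hypotheses (locW : localization iota) (locW' : localization iota')
  (tau_eq0 : forall p, (tau p == 0) = (p == 0))
  (fD : {morph f : u v / u + v}) (fZ : forall p v, f (p *: v) = tau p *: f v).

(** Used with [tau] a translation for the action of [a] and [c], and with [tau] the identity for
    isomorphisms. The value is read on a chosen fraction; injectivity of [iota] makes it independent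
    of the choice. *)
Lemma localization_extend : exists F : M -> M', {morph F : u v / u + v} /\
  forall v p, p != 0 -> F ((frc p)^-1 *: iota v) = (frc (tau p))^-1 *: iota' (f v).
Proof.
have [iD iZ i0 isurj] := locW; have [i'D i'Z i'0 _] := locW'.
have ex m : exists vp : W * {poly C}, vp.2 != 0 /\ m = (frc vp.2)^-1 *: iota vp.1.
  by have [v [p H]] := isurj m; exists (v, p).
pose vp m := projT1 (cid (ex m)).
have vpP m : (vp m).2 != 0 /\ m = (frc (vp m).2)^-1 *: iota (vp m).1.
  exact: projT2 (cid (ex m)).
pose F m := (frc (tau (vp m).2))^-1 *: iota' (f (vp m).1).
have iN v : iota (- v) = - iota v by rewrite -scaleN1r iZ /frc tofracN tofrac1 scaleN1r.
have key v p : p != 0 -> F ((frc p)^-1 *: iota v) = (frc (tau p))^-1 *: iota' (f v).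
  move=> nzp; rewrite /F; have [] := vpP ((frc p)^-1 *: iota v).
  case: (vp _) => u q /= nzq E.
  have Eqv : q *: v = p *: u.
    apply/eqP; rewrite -subr_eq0; apply/eqP/i0; rewrite iD iN !iZ.
    apply/eqP; rewrite subr_eq0; apply/eqP.
    have /(congr1 (fun x => (frc p * frc q) *: x)) := E.
    rewrite !scalerA mulrAC mulfV ?frc_eq0 // mul1r => ->.
    by rewrite -mulrA mulfV ?frc_eq0 // mulr1.
  have nzt r : r != 0 -> frc (tau r) != 0 by rewrite frc_eq0 tau_eq0.
  apply: (scalerI (mulf_neq0 (nzt _ nzp) (nzt _ nzq))).
  rewrite !scalerA -mulrA mulfV ?nzt // mulr1 mulrAC mulfV ?nzt // mul1r.
  by rewrite -!i'Z -!fZ Eqv.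
exists F; split=> // m m'.
have [v [p [nzp ->]]] := isurj m; have [u [q [nzq ->]]] := isurj m'.
have -> : (frc p)^-1 *: iota v + (frc q)^-1 *: iota u =
    (frc (p * q))^-1 *: iota (q *: v + p *: u).
  by rewrite iD !iZ /frc tofracM scale_common_denominator ?tofrac_eq0.
rewrite !key ?mulf_neq0 // fD !fZ i'D !i'Z rmorphM /frc tofracM.
by rewrite scale_common_denominator ?tofrac_eq0 ?tau_eq0.
Qed.
End Localization.

(** * Rationalization of torsion free modules *)

Section Sl2ModSemilinear.
Variables (C : numFieldType) (V : lmodType C) (rho : sl2mod V).

Definition zmod : lmodType {poly C} := polymod (L0 rho).

Lemma sl2mod_semilinear : sl2_semilinear (W := zmod) (Lm1 rho) (L1 rho).
Proof.
have [r1 r2 r3] := sl2_rel rho.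
have aD : {morph Lm1 rho : u v / u + v} by exact: (raddfD (Lm1 rho)).
have cD : {morph L1 rho : u v / u + v} by exact: (raddfD (L1 rho)).
split=> //.
- apply: semilinear_from_X => [||v] //.
    by move=> k v; rewrite !(polymodC (L0 rho)) linearZ.
  rewrite scalerBl polyC1 scale1r !(polymodX (L0 rho)) /=.
  by apply/eqP; rewrite eq_sym subr_eq addrC -subr_eq r3.
- apply: semilinear_from_X => [||v] //.
    by move=> k v; rewrite !(polymodC (L0 rho)) linearZ.
  rewrite scalerBl polyCN polyC1 scaleN1r opprK !(polymodX (L0 rho)) /=.
  by have /eqP := r2 v; rewrite subr_eq addrC => /eqP->; rewrite subrK.
- by move=> v; rewrite (polymodX (L0 rho)); exact: r1.
Qed.

Lemma torsion_freeE : torsion_free rho -> ztorsion_free zmod.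
Proof.
move=> tf p v pv; have [->|nzp] := eqVneq p 0; [by left | right].
exact: tf nzp pv.
Qed.

Lemma submodule_zstable (P : V -> Prop) :
  submodule rho P <-> zstable (W := zmod) (Lm1 rho) (L1 rho) P.
Proof.
split=> [[P0 PD PZ [Pa Pb Pc]]|[P0 PD PZ Pa Pc]]; split=> //.
  move=> p u Pu; change (P (pact (L0 rho) p u)); rewrite /pact.
  apply: big_ind => // i _; apply: PZ.
  by elim: (nat_of_ord i) => //= k; exact: Pb.
- by move=> k u Pu; rewrite -(polymodC (L0 rho)); exact: PZ.
- by split=> // u Pu; rewrite -(polymodX (L0 rho)); exact: PZ.
Qed.

Lemma simple_zsimple : simple_mod rho -> zsimple (W := zmod) (Lm1 rho) (L1 rho).
Proof. by move=> [_ simp] P /submodule_zstable; exact: simp. Qed.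

Lemma zsimple_simple : (exists v : V, v != 0) ->
  zsimple (W := zmod) (Lm1 rho) (L1 rho) -> simple_mod rho.
Proof. by move=> nz simp; split=> // P /submodule_zstable; exact: simp. Qed.
End Sl2ModSemilinear.

Section RatInverse.
Variables (C : numFieldType) (M : lmodType (ratfun C)).

Lemma semilinear_inv (f : M -> M) (s : C) p m : p != 0 ->
  (forall p m, f (frc p *: m) = frc (shift s p) *: f m) ->
  f ((frc p)^-1 *: m) = (frc (shift s p))^-1 *: f m.
Proof.
move=> nzp fZ; have nzs : frc (shift s p) != 0 by rewrite frc_eq0 shift_eq0.
by apply: (scalerI nzs); rewrite -fZ scalerA mulfV ?frc_eq0 // scale1r scalerA mulfV // scale1r.
Qed.
End RatInverse.

Section Rationalization.
Variables (C : numFieldType) (V : lmodType C) (rho : sl2mod V).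
Variables (M : lmodType (ratfun C)).

Lemma rationalization_localization (sigma : ratmod M) (iota : V -> M) :
  torsion_free rho -> rationalization rho sigma iota ->
  [/\ localization (W := zmod rho) iota,
      forall v, iota (Lm1 rho v) = Qm1 sigma (iota v) &
      forall v, iota (L1 rho v) = Q1 sigma (iota v)].
Proof.
move=> tf [il iX i0 isurj iact].
have frc1 : (frc 1 : ratfun C)^-1 = 1 by rewrite /frc tofrac1 invr1.
have iD : {morph iota : u v / u + v}.
  by move=> u v; have := il 1 u v; rewrite /cscale polyC1 /frc tofrac1 !scale1r.
split.
- split=> //.
  + move=> p v; elim/poly_ind: p v => [|p k IH] v.
      rewrite /frc tofrac0 !scale0r.
      by apply: (addrI (iota 0)); rewrite -iD !addr0.
    rewrite scalerDl iD -scalerA IH (polymodX (L0 rho)) iX (polymodC (L0 rho)).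
    have := il k v 0; rewrite addr0 (_ : iota 0 = 0); last first.
      by apply: (addrI (iota 0)); rewrite -iD !addr0.
    by rewrite addr0 => ->; rewrite /cscale /frc tofracD tofracM scalerDl scalerA.
  + by move=> v /i0[p nzp pv]; exact: tf nzp pv.
  + by move=> m; have [v [p nzp E]] := isurj m; exists v, p.
- move=> v; have [+ _ _] := iact v 1 (oner_neq0 _).
  by rewrite rmorph1 frc1 !scale1r.
- move=> v; have [_ _ +] := iact v 1 (oner_neq0 _).
  by rewrite rmorph1 frc1 !scale1r.
Qed.

(** It suffices to compare the actions on [iota v]: a semilinear map takes [p^-1] out as the inverse
    of the translated [p], which is the prescribed formula. *)
Lemma localization_rationalization (sigma : ratmod M) (iota : V -> M) :
  localization (W := zmod rho) iota ->
  (forall v, iota (Lm1 rho v) = Qm1 sigma (iota v)) ->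
  (forall v, iota (L1 rho v) = Q1 sigma (iota v)) ->
  rationalization rho sigma iota.
Proof.
move=> [iD iZ i0 isurj] ia ic.
have [_ _ aZ cZ _] := ratmod_semilinear sigma.
split.
- by move=> k u w; rewrite iD -(polymodC (L0 rho)) iZ.
- by move=> v; rewrite -(polymodX (L0 rho)) iZ.
- move=> v; split=> [/i0 ->|[p nzp pv]].
    exists 1; first exact: oner_neq0.
    exact: (scaler0 (zmod rho) (1 : {poly C})).
  have /eqP := iZ p v; rewrite (pv : p *: (v : zmod rho) = 0).
  rewrite (_ : iota 0 = 0); last by apply: (addrI (iota 0)); rewrite -iD !addr0.
  by rewrite eq_sym scaler_eq0 frc_eq0 (negPf nzp) => /eqP.
- by move=> m; have [v [p [nzp E]]] := isurj m; exists v, p.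
move=> v p nzp; split.
- by rewrite (semilinear_inv _ nzp aZ) ia /shift polyC1.
- by rewrite (Q0_z sigma).
- by rewrite (semilinear_inv _ nzp cZ) ic /shift polyCN polyC1 opprK.
Qed.

Lemma localization_ratmod (iota : V -> M) (h : nat) (e : 'I_h -> M) :
  (forall m : M, exists d : 'I_h -> ratfun C, m = \sum_i d i *: e i) ->
  localization (W := zmod rho) iota -> exists sigma : ratmod M, rationalization rho sigma iota.
Proof.
move=> span loc; have [iD iZ i0 isurj] := loc.
have [aD cD aZ cZ r1] := sl2mod_semilinear rho.
have [A [AD AE]] := localization_extend loc loc (shift_eq0 1) aD aZ.
have [B [BD BE]] := localization_extend loc loc (shift_eq0 (-1)) cD cZ.
have linF (F : M -> M) (f : V -> V) s : {morph F : u v / u + v} ->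
    (forall (p : {poly C}) (v : zmod rho), f (p *: v) = (shift s p *: (f v : zmod rho))) ->
    (forall v p, p != 0 -> F ((frc p)^-1 *: iota v) = (frc (shift s p))^-1 *: iota (f v)) ->
    forall q m, F (frc q *: m) = frc (shift s q) *: F m.
  move=> FD fZ FE q m; have [v [p [nzp ->]]] := isurj m.
  rewrite scalerA mulrC -scalerA -[frc q *: iota v]iZ !FE // fZ iZ !scalerA.
  by rewrite mulrC.
have Clin (F : M -> M) s : {morph F : u v / u + v} ->
    (forall q m, F (frc q *: m) = frc (shift s q) *: F m) -> Clinear_rat F.
  by move=> FD FZ k u w; rewrite FD /cscale FZ shiftC.
have AZ := linF A (Lm1 rho) 1 AD aZ AE; have BZ := linF B (L1 rho) (-1) BD cZ BE.
have X_lin : Clinear_rat (fun m : M => frc 'X *: m).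
  by move=> k u w; rewrite scalerDr /cscale !scalerA mulrC.
have rel : sl2_brackets A (fun m => frc 'X *: m) B.
  split=> m.
  - have [v [p [nzp ->]]] := isurj m.
    rewrite AE // BE ?shift_eq0 // BE // AE ?shift_eq0 //= !shiftD subrr addNr !shift0.
    have iN u : iota (- u) = - iota u.
      by rewrite -(scaleN1r (u : zmod rho)) iZ /frc tofracN tofrac1 scaleN1r.
    have -> : frc 'X *: ((frc p)^-1 *: iota v) = (frc p)^-1 *: iota ('X *: (v : zmod rho)).
      by rewrite iZ !scalerA mulrC.
    by rewrite -scalerBr -iN -iD r1 [RHS]scalerMnr !mulr2n iD.
  - rewrite BZ shiftX polyCN opprK polyC1 /frc tofracD tofrac1 scalerDl scale1r.
    by rewrite opprD addrA subrr sub0r.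
  - rewrite AZ shiftX polyC1 /frc tofracB tofrac1 scalerBl scale1r.
    by rewrite subKr.
have fin : exists s : seq M, forall m : M, exists c : 'I_(size s) -> ratfun C,
    m = \sum_(i < size s) c i *: s`_i.
  exists [seq e i | i <- enum 'I_h] => m; have [d ->] := span m.
  by have [c E] := sum_seq_of_ord e d; exists c.
exists (RatMod (Clin A 1 AD AZ) X_lin (Clin B (-1) BD BZ) rel (fun=> erefl) fin).
apply: localization_rationalization => //= v.
- have := AE v 1 (oner_neq0 _); rewrite rmorph1 /frc tofrac1 invr1 !scale1r.
  by move->.
- have := BE v 1 (oner_neq0 _); rewrite rmorph1 /frc tofrac1 invr1 !scale1r.
  by move->.
Qed.
End Rationalization.

(** * Simple torsion free modules: finite rank and rationalization *)

Section SimpleTorsionFree.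
Variables (C : numClosedFieldType) (V : lmodType C) (rho : sl2mod V).
Hypotheses (Cuncount : ~ countable [set: C]) (simpleV : simple_mod rho)
  (tfV : torsion_free rho).

Lemma simple_cas_scalar :
  exists mu : C, forall v : zmod rho, cas (W := zmod rho) (Lm1 rho) (L1 rho) v = mu%:P *: v.
Proof.
have ac := sl2mod_semilinear rho.
pose f : V -> V := cas (W := zmod rho) (Lm1 rho) (L1 rho).
have f_lin : linear f.
  move=> k u v; rewrite /f (casD ac); congr (_ + _).
  by rewrite -(polymodC (L0 rho)) (casZ ac) -(polymodC (L0 rho)).
pose F : {linear V -> V} := HB.pack f (GRing.isLinear.Build C V V *:%R f f_lin).
have [mu muE] := commuting_scalar Cuncount simpleV (f := F) (cas_a ac)
  (fun v => etrans (etrans (congr1 f (esym (polymodX (L0 rho) v))) (casZ ac 'X v))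
                   (polymodX (L0 rho) _)) (cas_c ac).
by exists mu => v; rewrite (polymodC (L0 rho)); exact: muE.
Qed.

Lemma simple_torsion_free_rank : exists h (e : 'I_h -> zmod rho),
    (forall d : 'I_h -> {poly C}, \sum_i d i *: e i = 0 -> forall i, d i = 0) /\
    forall w : zmod rho, exists2 p : {poly C}, p != 0 &
      exists d : 'I_h -> {poly C}, p *: w = \sum_i d i *: e i.
Proof.
have [mu muE] := simple_cas_scalar; case: (simpleV) => nz _.
exact: (simple_free_rank (sl2mod_semilinear rho) muE (torsion_freeE tfV)
          (simple_zsimple simpleV) nz).
Qed.

Theorem simple_finite_rank : finite_rank rho.
Proof.
have [h [e [_ span]]] := simple_torsion_free_rank.
exists [seq e i | i <- enum 'I_h] => v.
have [p nzp [d E]] := span v; exists p => //.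
by have [c Ec] := sum_seq_of_ord e d; exists c; rewrite -Ec -E.
Qed.

Theorem simple_rationalization :
  exists (M : lmodType (ratfun C)) (sigma : ratmod M) (iota : V -> M),
    rationalization rho sigma iota.
Proof.
have [h [e [indep span]]] := simple_torsion_free_rank.
have [iota loc] := localization_exists (torsion_freeE tfV) indep span.
have [sigma rat] := localization_ratmod (rho := rho) (e := fun i => delta_mx 0 i)
  (fun m => ex_intro _ (fun i => m 0 i) (row_sum_delta m)) loc.
by exists 'rV[ratfun C]_h, sigma, iota.
Qed.
End SimpleTorsionFree.

(** * Eigenvectors of the Casimir operator on rational modules *)

Lemma size_shift_sub (C : numFieldType) (s : C) (p : {poly C}) : p != 0 ->
  (size (shift s p - p)%R < size p)%N.
Proof.
move=> nzp; have sz : size (shift s p) = size p by rewrite size_comp_poly2 ?size_XsubC.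
rewrite [X in (_ < X)%N]polySpred // ltnS; apply/leq_sizeP => j; rewrite coefB.
rewrite leq_eqVlt => /orP[/eqP<-|ltj].
  (* Translation keeps the leading coefficient, so the top terms cancel. *)
  have := @lead_coef_comp _ p ('X - s%:P); rewrite size_XsubC => /(_ isT).
  rewrite lead_coefXsubC expr1n mulr1 -/(shift s p) !lead_coefE sz => ->.
  by rewrite subrr.
by rewrite !nth_default ?subrr ?sz // polySpred.
Qed.

Section Annihilator.
Variables (F : fieldType) (M : lmodType F) (f : {linear M -> M}).

(** Each generator is killed by a polynomial in [f], since its iterates are dependent; these
    polynomials commute, so their product kills everything. *)
Lemma finite_annihilator (s : seq M) :
  (forall m : M, exists c : 'I_(size s) -> F, m = \sum_(i < size s) c i *: s`_i) ->
  exists2 q : {poly F}, q != 0 & forall m : polymod f, q *: m = 0.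
Proof.
move=> span.
have ann m : exists2 q : {poly F}, q != 0 & q *: (m : polymod f) = 0.
  have [//|d [i nzi] d0] := @span_dependent F M (size s) (fun i => s`_i)
    (fun k => iter k f m).
  exists (\poly_(j < (size s).+1) d (inord j)).
    apply: contraNneq nzi => /(congr1 (fun q : {poly F} => q`_i)).
    by rewrite coef_poly ltn_ord inord_val coef0 => ->.
  rewrite polymodE (polyactE _ _ (size_poly _ _)) -[RHS]d0; apply: eq_bigr => j _.
  by rewrite coef_poly ltn_ord inord_val.
pose q i := s2val (cid2 (ann s`_i)).
have nzq i : q i != 0 by exact: s2valP (cid2 (ann s`_i)).
have qs i : q i *: (s`_i : polymod f) = 0 by exact: s2valP' (cid2 (ann s`_i)).
exists (\prod_(i < size s) q i); first by apply/prodf_neq0.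
move=> m; have [c ->] := span m; rewrite scaler_sumr big1 // => i _.
rewrite -(polymodC f) scalerA mulrC -scalerA (bigD1 i) //= mulrC -scalerA qs.
by rewrite !scaler0.
Qed.
End Annihilator.

Section CasimirEigenvector.
Variables (C : numClosedFieldType) (M : lmodType (ratfun C)) (sigma : ratmod M).
Local Notation W := (zrat M).
Local Notation a := (Qm1 sigma).
Local Notation c := (Q1 sigma).
Local Notation theta := (cas (W := W) a c).
Let ac := ratmod_semilinear sigma.

Lemma cas_fracZ (x : ratfun C) (m : M) : theta (x *: m) = x *: (theta m : M).
Proof.
have [n [d nzd E]] := fraction_numden x.
have nz : frc d != 0 by rewrite frc_eq0.
apply: (scalerI nz); rewrite -[LHS](casZ ac d) scalerA E.
by rewrite zratE scalerA E (casZ ac n).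
Qed.

(** The Casimir operator is packed as a linear map over [C(z)], over [C[z]] and over [C], so that
    polynomials in it may take coefficients in each of the three rings. *)
Fact cas_rat_linear : linear (theta : M -> M).
Proof. by move=> k u v; rewrite (casD ac) -cas_fracZ. Qed.
Definition cas_rat : {linear M -> M} :=
  HB.pack (theta : M -> M) (GRing.isLinear.Build _ M M *:%R theta cas_rat_linear).

Fact cas_z_linear : linear (theta : W -> W).
Proof. by move=> k u v; rewrite (casD ac) (casZ ac). Qed.
Definition cas_z : {linear W -> W} :=
  HB.pack (theta : W -> W) (GRing.isLinear.Build _ W W *:%R theta cas_z_linear).

Definition crat : lmodType C := resmod M (@FracField.tofrac {poly C} \o polyC).

Lemma cratE k (m : crat) : k *: m = k%:P *: (m : W). Proof. by []. Qed.

Fact cas_c_linear : linear (theta : crat -> crat).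
Proof. by move=> k u v; rewrite !cratE (casD ac) (casZ ac). Qed.
Definition cas_c_lin : {linear crat -> crat} :=
  HB.pack (theta : crat -> crat) (GRing.isLinear.Build _ crat crat *:%R theta cas_c_linear).

Lemma cas_polynomial_relation :
  exists2 P : {poly {poly C}}, P != 0 & forall m : polymod cas_z, P *: m = 0.
Proof.
have [s span] := rat_fin sigma.
have [q nzq q0] := finite_annihilator cas_rat span.
have [d nzd [p pE]] := common_denominator (fun i : 'I_(size q) => q`_i).
pose P := \poly_(j < size q) (if insub j is Some i then p i else 0).
have PE (i : 'I_(size q)) : P`_i = p i by rewrite coef_poly ltn_ord valK.
exists P.
  apply: contraNneq nzq => P0; apply/eqP/polyP => i; rewrite coef0.
  have [lti|] := ltnP i (size q); last by move/(nth_default 0).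
  have := pE (Ordinal lti); rewrite -PE P0 coef0 tofrac0 /= => /eqP.
  by rewrite mulf_eq0 tofrac_eq0 (negPf nzd) => /eqP.
move=> m; rewrite polymodE (polyactE _ _ (size_poly _ _)).
have := q0 m; rewrite polymodE /polyact => /(congr1 ( *:%R (frc d))).
rewrite scaler0 scaler_sumr => E; rewrite -[RHS]E; apply: eq_bigr => i _.
by rewrite scalerA [frc d * _]pE PE.
Qed.

Section Nilpotent.
Variables (T : W -> W) (s : C).
Hypotheses (nzs : s != 0) (TD : {morph T : u v / u + v})
  (TZ : forall p v, T (p *: v) = shift s p *: T v)
  (Ttheta : forall v, theta (T v) = T (theta v))
  (no_eigen : forall mu x, theta x = mu%:P *: x -> x = 0).

(* Among the polynomial relations [P(z, theta) = 0] on some [T^k M], one of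
   least degree in [z] has coefficients invariant under the shift, since
   [P(z - s, theta) - P(z, theta)] vanishes on [T^(k+1) M]; so [q(theta)]
   kills [T^k M] for some nonzero [q] over [C]. *)
Lemma no_eigen_nilpotent : exists k, forall m, iter k T m = 0.
Proof.
have Titer i x : T (iter i theta x) = iter i theta (T x).
  by elim: i => //= i <-; rewrite Ttheta.
have TP (P : {poly {poly C}}) (x : W) :
    T (P *: (x : polymod cas_z)) = map_poly (shift s) P *: (T x : polymod cas_z).
  rewrite !polymodE /polyact (semilin_sum TD) size_map_inj_poly ?rmorph0 //; last first.
    exact: can_inj (shiftK s).
  by apply: eq_bigr => i _; rewrite TZ coef_map Titer.
pose A n := exists P : {poly {poly C}}, [/\ P != 0, forall i, (size (P`_i)%R <= n)%N &
  exists k, forall x : W, P *: (iter k T x : polymod cas_z) = 0].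
have exA : exists n, `[< A n >].
  have [P nzP P0] := cas_polynomial_relation.
  exists (\max_(i < size P) size (P`_i)%R)%N; apply/asboolP; exists P; split=> //.
    move=> i; have [lti|/(nth_default 0)->] := ltnP i (size P); last by rewrite size_poly0.
    exact: (leq_bigmax (Ordinal lti)).
  by exists 0%N => x; exact: P0.
case: (ex_minnP exA) => n /asboolP[P [nzP Pn [k Pk]]] minn.
have Pinv i : shift s P`_i = P`_i.
  pose Q := map_poly (shift s) P - P.
  suff Q0 : Q = 0.
    by have := congr1 (fun R : {poly {poly C}} => R`_i) Q0; rewrite coefB coef_map coef0
       => /eqP; rewrite subr_eq0 => /eqP.
  apply/eqP; apply: contraT => nzQ.
  have Qi j : (size (Q`_j)%R <= n.-1)%N.
    rewrite coefB coef_map /=; have [->|nz] := eqVneq P`_j 0.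
      by rewrite rmorph0 subrr size_poly0.
    have := leq_trans (size_shift_sub s nz) (Pn j).
    by case: (n).
  have lt0n : (0 < n)%N.
    rewrite lt0n; apply: contraNneq nzP => n0; apply/eqP/polyP => j; rewrite coef0.
    by apply/eqP; rewrite -size_poly_leq0 -n0.
  suff : (n <= n.-1)%N by rewrite leqNgt ltn_predL lt0n.
  apply: minn; apply/asboolP; exists Q; split=> //; exists k.+1 => x.
  (* The translate of [P] vanishes on [T^(k+1) M] because [T] carries the relation on [T^k M] to it;
     [P] vanishes there because [T^(k+1) M] lies in [T^k M]. *)
  rewrite scalerBl -[X in X - _]TP Pk (semilin0 TD) iterSr Pk.
  by rewrite subrr.
pose q : {poly C} := \poly_(i < size P) (P`_i)`_0.
have PE i : P`_i = (q`_i)%:P.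
  rewrite coef_poly; case: ltnP => [_|/(nth_default 0)->//].
  exact: shift_invariant nzs (Pinv i).
have nzq : q != 0.
  by apply: contraNneq nzP => q0; apply/eqP/polyP => i; rewrite PE q0 !coef0.
exists k => m; apply: (polymod_torsion_free (f := cas_c_lin) _ nzq).
  by move=> mu x; exact: no_eigen.
rewrite polymodE (polyactE _ _ (size_poly _ _)) -[RHS](Pk m) polymodE.
by apply: eq_bigr => i _; rewrite PE.
Qed.
End Nilpotent.

(** Otherwise [a] and [c] are nilpotent, which gives nonzero [x] killed by [a] and [y = c^n x]
    killed by [c]. The Casimir operator multiplies [x] by [z(z+1)], hence [y] both by [z(z-1)] and
    by [(z+n)(z+n+1)], two distinct polynomials. *)
Lemma cas_eigenvector (m0 : M) : m0 != 0 ->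
  exists mu (x : W), x != 0 /\ theta x = mu%:P *: x.
Proof.
move=> nz0; apply: contrapT => noex.
have no_eigen mu x : theta x = mu%:P *: x -> x = 0.
  move=> Ex; apply/eqP; apply: contra_notT noex => nzx; by exists mu, x.
have [aD cD aZ cZ _] := ac.
have last_nz (T : W -> W) (x : W) : (exists k, forall m, iter k T m = 0) -> x != 0 ->
    exists k, iter k T x != 0 /\ T (iter k T x) = 0.
  move=> [k /(_ x) Tk] nzx.
  have ex : exists k, iter k T x == 0 by exists k; apply/eqP.
  case: (ex_minnP ex) => -[|j] /eqP Tj minj; first by rewrite -Tj eqxx in nzx.
  exists j; split; last exact: Tj.
  by apply: contraT => /negPn /minj; rewrite ltnn.
have [k [nzx ax]] := last_nz _ _ (no_eigen_nilpotent (oner_neq0 _) aD aZ (cas_a ac) no_eigen) nz0.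
set x := iter k _ _ in nzx ax.
have nzN1 : (-1 : C) != 0 by rewrite oppr_eq0 oner_neq0.
have [n [nzy cy]] := last_nz _ _ (no_eigen_nilpotent nzN1 cD cZ (cas_c ac) no_eigen) nzx.
set y := iter n _ _ in nzy cy.
have thx : theta x = ('X * ('X + 1)) *: x.
  by apply/eqP; rewrite eq_sym -subr_eq0 -(cas_ca ac) ax (semilin0 cD).
have thy : theta y = ('X * ('X - 1)) *: y.
  by apply/eqP; rewrite eq_sym -subr_eq0 -cas_ac cy (semilin0 aD).
have thcn i : theta (iter i c x) = iter i c (theta x).
  by elim: i => //= i <-; rewrite (cas_c ac).
move: thy; rewrite /y thcn thx (semilin_iterZ cZ) => /eqP.
rewrite -subr_eq0 -scalerBl => /eqP/zrat_torsion_free[]; last by move=> y0; case/eqP: nzy.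
(* At [z = 1] the comparison reads [(n+1)(n+2) = 0]. *)
move/(congr1 (horner^~ 1)); rewrite /= hornerD hornerN horner_shift !hornerM !hornerD !hornerN
  !hornerX !hornerC subrr mulr0 subr0 mulNrn opprK nat1r natr1 => /eqP.
by rewrite mulf_eq0 !pnatr_eq0.
Qed.

Theorem R_simple_casimir : R_simple sigma -> casimir sigma.
Proof.
move=> [[m0 nz0] simp]; have [mu [x [nzx Ex]]] := cas_eigenvector nz0.
exists mu => m; rewrite casimir_opE /cscale.
have [aD cD aZ cZ _] := ac.
apply: (simp (fun m => theta m = mu%:P *: (m : W))); last by exists x.
split.
- by rewrite scaler0 -(scale0r (0 : W)) (casZ ac) !scale0r.
- by move=> u w Eu Ew; rewrite (casD ac) Eu Ew scalerDr.
- by move=> k u Eu; rewrite cas_fracZ Eu !zratE !scalerA mulrC.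
split=> u Eu.
- by rewrite (cas_a ac) Eu aZ shiftC.
- by rewrite (Q0_z sigma) -zratE (casZ ac) Eu !scalerA mulrC.
- by rewrite (cas_c ac) Eu cZ shiftC.
Qed.
End CasimirEigenvector.

(** * Membership in a submodule, point by point *)

Lemma ideal_without_zero (C : closedFieldType) (I : {poly C} -> Prop) :
  (forall f g, I f -> I g -> I (f + g)) -> (forall f g, I g -> I (f * g)) ->
  (forall x, exists2 f, I f & f.[x] != 0) -> I 1.
Proof.
move=> ID IM Inz.
have ex : exists n, `[< exists f, [/\ I f, f != 0 & size f = n] >].
  have [f If nzf] := Inz 0; exists (size f); apply/asboolP; exists f; split=> //.
  by apply: contraNneq nzf => ->; rewrite horner0.
case: (ex_minnP ex) => n /asboolP[g [Ig nzg szg]] ming.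
have [/eqP/size_poly1P[k nzk gE]|] := eqVneq (size g) 1%N.
  have -> : 1 = (k^-1)%:P * g by rewrite gE -polyCM mulVf.
  exact: IM.
(* An element of least degree divides all others, so its root would be a common zero of the
   ideal. *)
move=> /closed_rootP[x rgx]; have [f If] := Inz x.
have Ir : I (f %% g).
  rewrite (_ : f %% g = f + (- (f %/ g)) * g); first exact/ID/IM.
  by apply/eqP; rewrite mulNr eq_sym subr_eq addrC -divp_eq.
suff r0 : f %% g = 0 by rewrite (divp_eq f g) r0 addr0 hornerM (rootP rgx) mulr0 eqxx.
apply/eqP; apply: contraT => nzr.
have := ltn_modp f g; rewrite nzg => lt.
suff : (n <= size (f %% g)%R)%N by rewrite -szg leqNgt lt.
by apply: ming; apply/asboolP; exists (f %% g).
Qed.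

Section NaturalBound.
Variable C : numClosedFieldType.

Lemma nat_in_seq_bounded (D : seq C) : exists B, forall n, n%:R \in D -> (n <= B)%N.
Proof.
elim: D => [|x D [B HB]]; first by exists 0.
have [[m xm]|nom] := pselect (exists m, x = m%:R).
  exists (maxn m B) => n; rewrite inE => /orP[|/HB leB]; last by rewrite leq_max leB orbT.
  by rewrite xm eqr_nat => /eqP->; rewrite leq_maxl.
exists B => n; rewrite inE => /orP[/eqP xn|/HB//].
by case: nom; exists n.
Qed.

Lemma root_seq (g : {poly C}) : g != 0 -> exists r : seq C, forall x, g.[x] = 0 -> x \in r.
Proof.
move=> nzg; have [r E] := closed_field_poly_normal g; exists r => x /eqP.
by rewrite -[_ == 0]/(root g x) E rootZ ?lead_coef_eq0 // root_prod_XsubC.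
Qed.

Lemma no_root_far (g : {poly C}) (x s : C) : g != 0 -> s != 0 ->
  exists K, forall j, (K <= j)%N -> g.[x - s *+ j] != 0.
Proof.
move=> nzg nzs; have [r rP] := root_seq nzg.
have [B BP] := nat_in_seq_bounded [seq (x - y) / s | y <- r].
exists B.+1 => j ltBj; apply: contraTneq ltBj => /rP gj; rewrite -leqNgt.
apply: BP; apply/mapP; exists (x - s *+ j) => //.
by rewrite subKr -(mulr_natl s) mulfK.
Qed.
End NaturalBound.

Section Descent.
Variables (C : numClosedFieldType) (W : lmodType {poly C}).
Variables (T : W -> W) (s : C) (P : W -> Prop).
Hypotheses (TZ : forall p v, T (p *: v) = shift s p *: T v)
  (P0 : P 0) (PD : forall u v, P u -> P v -> P (u + v))
  (PZ : forall p u, P u -> P (p *: u)) (PT : forall u, P u -> P (T u)).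

(* Membership in the localization of [P] at the point [x]. *)
Definition loc (x : C) (v : W) := exists2 f : {poly C}, f.[x] != 0 & P (f *: v).

Lemma loc0 x : loc x 0.
Proof. by exists 1; rewrite ?scaler0 // hornerC oner_neq0. Qed.

Lemma locD x u v : loc x u -> loc x v -> loc x (u + v).
Proof.
move=> [f nzf Pf] [g nzg Pg]; exists (f * g); first by rewrite hornerM mulf_neq0.
rewrite scalerDr; apply: PD; last by rewrite -scalerA; exact: PZ.
by rewrite mulrC -scalerA; exact: PZ.
Qed.

Lemma locZ x p v : loc x v -> loc x (p *: v).
Proof.
by move=> [f nzf Pf]; exists f => //; rewrite scalerA mulrC -scalerA; exact: PZ.
Qed.

Lemma loc_div x p v : p.[x] != 0 -> loc x (p *: v) -> loc x v.
Proof.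
move=> nzp [f nzf Pf]; exists (f * p); first by rewrite hornerM mulf_neq0.
by rewrite -scalerA.
Qed.

Lemma loc_iter x i v : loc (x - s *+ i) v -> loc x (iter i T v).
Proof.
move=> [f nzf Pf]; exists (shift (s *+ i) f); first by rewrite horner_shift.
by rewrite -(semilin_iterZ TZ); elim: i {nzf} => //= i; exact: PT.
Qed.

Definition shift_prod (p : {poly C}) (J : nat) := \prod_(0 <= j < J) shift (s *+ j) p.

(** The relation writes [p v] through the [T^(i+1) v], and membership of that vector at [x] follows
    from membership of [v] at [x - s (i+1)], where fewer steps remain. Each step costs one
    translated factor [p]; [shift_prod] gathers them. *)
Lemma loc_descent (p : {poly C}) h (d : 'I_h -> {poly C}) (v : W) :
  p *: v = \sum_(i < h) d i *: iter i.+1 T v ->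
  forall J x, (forall j, (J <= j)%N -> loc (x - s *+ j) v) -> loc x (shift_prod p J *: v).
Proof.
move=> E; elim/ltn_ind => -[|J] IH x locJ.
  by apply: locZ; have := locJ 0 isT; rewrite mulr0n subr0.
rewrite /shift_prod big_nat_recl // mulr0n shift0 mulrC -scalerA E scaler_sumr.
apply: big_ind => [||i _]; [exact: loc0|exact: locD|].
rewrite scalerA mulrC -scalerA; apply: locZ.
have locE : loc x (shift (s *+ i.+1) (shift_prod p (J - i)) *: iter i.+1 T v).
  rewrite -(semilin_iterZ TZ); apply: loc_iter; apply: IH => [|j lej].
    by rewrite ltnS leq_subr.
  by rewrite -addrA -opprD -mulrnDr; apply: locJ; rewrite addSn ltnS -leq_subLR.
(* The factors from index [i] on are those supplied by the induction. When [J < i], the truncated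
   difference [J - i] is 0 and that product is empty. *)
have [leiJ|ltJi] := leqP i J; last first.
  by move: locE; rewrite /shift_prod (eqP (ltnW ltJi)) big_geq // rmorph1 scale1r;
    exact: locZ.
rewrite (@big_cat_nat _ _ _ i) //= -scalerA; apply: locZ.
move: locE; rewrite /shift_prod rmorph_prod.
have -> // : \prod_(i <= j < J) shift (s *+ j.+1) p =
    \prod_(0 <= j < J - i) shift (s *+ i.+1) (shift (s *+ j) p).
rewrite -[nat_of_ord i in LHS]add0n big_addn; apply: eq_bigr => j _.
by rewrite shiftD -mulrnDr addSn addnC.
Qed.
End Descent.

(** * The smallest nonzero submodule of an RC-simple module *)

Section Socle.
Variables (C : numClosedFieldType) (M : lmodType (ratfun C)) (sigma : ratmod M).
Local Notation W := (zrat M).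
Local Notation a := (Qm1 sigma).
Local Notation c := (Q1 sigma).
Let ac := ratmod_semilinear sigma.
Hypothesis RCs : RC_simple sigma.

(** Finite dimension makes the iterates dependent over [C(z)]; after clearing denominators, a
    shortest relation has a nonzero constant term, which is isolated. *)
Lemma rat_relation (T : W -> W) (s : C) (v : W) : {morph T : u v / u + v} ->
  (forall p v, T (p *: v) = shift s p *: T v) -> (forall x, T x = 0 -> x = 0) ->
  exists2 p, p != 0 & exists h (d : 'I_h -> {poly C}),
    p *: v = \sum_(i < h) d i *: iter i.+1 T v.
Proof.
move=> TD TZ Tinj; have [b span] := rat_fin sigma.
have [//|d [i nzi] d0] := @span_dependent _ M (size b) (fun i => b`_i) (fun k => iter k T v).
have [q nzq [p pE]] := common_denominator d.
have [|h [e [e0 nze0 _ _]]] := minimal_relation TD TZ (v := v) Tinj.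
  exists (size b).+1, (fun k => p (inord k)); split; last first.
    have nzFq : FracField.tofrac q != 0 by rewrite tofrac_eq0.
    exists i => //; rewrite inord_val -(tofrac_eq0 (p i)) -pE.
    exact: mulf_neq0 nzFq nzi.
  have := congr1 ( *:%R (frc q)) d0; rewrite scaler0 scaler_sumr => E.
  rewrite -[RHS]E; apply: eq_bigr => j _; rewrite inord_val zratE scalerA.
  by rewrite /frc pE.
exists (e 0); first exact: nze0.
exists h, (fun i => - e i.+1).
move: e0; rewrite /rel_sum big_ord_recl => /eqP; rewrite addr_eq0 => /eqP->.
by rewrite -sumrN; apply: eq_bigr => j _; rewrite scaleNr.
Qed.

(** The vectors with a nonzero polynomial multiple in [P] form a [C(z)]-subspace stable under the
    action, hence everything by simplicity. *)
Lemma rat_dense (P : W -> Prop) : zstable (W := W) a c P ->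
  (exists2 v, P v & v != 0) ->
  forall m : W, exists2 g : {poly C}, g != 0 & P (g *: m).
Proof.
move=> [P0 PD PZ Pa Pc] nzP; have [[mu muE] [_ simp]] := RCs.
have [aD cD aZ cZ _] := ac.
apply: (simp (fun m : M => exists2 g : {poly C}, g != 0 & P (g *: (m : W)))).
- have Z (k : ratfun C) (u : M) : (exists2 g : {poly C}, g != 0 & P (g *: (u : W))) ->
        exists2 g : {poly C}, g != 0 & P (g *: (k *: u : W)).
      move=> [g nzg Pg]; have [n [d nzd E]] := fraction_numden k.
      exists (g * d); first by rewrite mulf_neq0.
      rewrite -scalerA (_ : d *: (k *: u : W) = n *: (u : W)); last first.
        by rewrite zratE scalerA E.
      by rewrite scalerA mulrC -scalerA; exact: PZ.
  split=> //.
    + by exists 1; rewrite ?oner_neq0 // scaler0.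
    + move=> u v [g nzg Pg] [f nzf Pf]; exists (g * f); first by rewrite mulf_neq0.
      rewrite scalerDr; apply: PD; last by rewrite -scalerA; exact: PZ.
      by rewrite mulrC -scalerA; exact: PZ.
    + split=> u Hu; last 2 first.
      * by rewrite (Q0_z sigma); exact: Z.
      * have [g nzg Pg] := Hu; exists (shift (-1) g); first by rewrite shift_eq0.
        by rewrite -cZ; exact: Pc.
      have [g nzg Pg] := Hu; exists (shift 1 g); first by rewrite shift_eq0.
      by rewrite -aZ; exact: Pa.
- by exists mu => m _; exact: muE.
- by have [v Pv nzv] := nzP; exists v => //; exists 1; rewrite ?oner_neq0 ?scale1r.
Qed.

Theorem rat_socle : exists2 w : W, w != 0 &
  forall P : W -> Prop, zstable (W := W) a c P -> (exists2 v, P v & v != 0) -> P w.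
Proof.
have [[mu muE] [[n0 nz0] simp]] := RCs.
have casmu (v : W) : cas (W := W) a c v = mu%:P *: v by rewrite -casimir_opE muE.
have tf := @zrat_torsion_free C M.
have [aD cD aZ cZ _] := ac.
have [pa nzpa [ha [da Ea]]] := rat_relation n0 aD aZ (a_inj ac casmu tf).
have [pc nzpc [hc [dc Ec]]] := rat_relation n0 cD cZ (c_inj ac casmu tf).
have [ra raP] := root_seq nzpa; have [rc rcP] := root_seq nzpc.
(* A natural number equal to a root of [pc] minus a root of [pa] is at most [B]; this bound is fixed
   before [P] is chosen. *)
have [B BP] := nat_in_seq_bounded [seq y - x | x <- ra, y <- rc].
exists (shift_prod 1 pa B.+1 *: (n0 : W)).
  apply: contra_neq nz0 => /tf[]// /eqP; rewrite prodf_seq_eq0 => /hasP[j _].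
  by rewrite shift_eq0 (negPf nzpa).
move=> P [P0 PD PZ Pa Pc] nzP.
have [g nzg Pg] := rat_dense (And5 P0 PD PZ Pa Pc) nzP n0.
have locg x : g.[x] != 0 -> loc P x n0 by exists g.
have nz1 : (1 : C) != 0 := oner_neq0 _.
have nzN1 : (-1 : C) != 0 by rewrite oppr_eq0.
(* The [f] with [f w] in [P] form an ideal, which contains 1 once it has no common zero. *)
rewrite -[X in P X]scale1r.
apply: (ideal_without_zero (I := fun f => P (f *: (shift_prod 1 pa B.+1 *: (n0 : W))))).
- by move=> f f' Pf Pf'; rewrite scalerDl; exact: PD.
- by move=> f f' Pf; rewrite -scalerA; exact: PZ.
move=> x; suff [f nzf Pf] : loc P x (shift_prod 1 pa B.+1 *: (n0 : W)) by exists f.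
(* If [pc] vanishes at some [x + k], then [pa] is nonzero at [x - j] for [j > B], so coming through
   [a] from the points [x - j] costs only the factors of [w]. Otherwise one comes through [c] from
   the points [x + j], and all its factors are nonzero at [x]. *)
have [[k ck]|noroot] := pselect (exists k, pc.[x + k%:R] = 0).
  have [K locK] := no_root_far x nzg nz1.
  have : loc P x (shift_prod 1 pa (maxn K B.+1) *: (n0 : W)).
    apply: (loc_descent aZ P0 PD PZ Pa Ea) => j; rewrite geq_max => /andP[leKj _].
    by apply: locg; exact: locK.
  rewrite /shift_prod (big_cat_nat (leq0n _) (leq_maxr K B.+1)) /= mulrC -scalerA.
  apply: loc_div; rewrite horner_prod prodf_seq_neq0; apply/allP => j.
  rewrite mem_index_iota => /andP[ltBj _]; rewrite horner_shift.
  apply: contraTneq ltBj => paj; rewrite -leqNgt.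
  apply: leq_trans (leq_addl k j) (BP _ _); apply/allpairsP.
  exists (x - 1 *+ j, x + k%:R); rewrite raP // rcP //; split=> //=.
  by rewrite opprB addrC addrA subrK -natrD addnC.
have [K locK] := no_root_far x nzg nzN1.
apply: (locZ PZ); apply: (@loc_div _ _ _ x (shift_prod (-1) pc K)).
  rewrite horner_prod prodf_seq_neq0; apply/allP => j _; rewrite horner_shift.
  apply/eqP => bad; apply: noroot; exists j.
  by rewrite mulNrn opprK in bad.
apply: (loc_descent cZ P0 PD PZ Pc Ec) => j leKj.
by apply: locg; exact: locK.
Qed.
End Socle.

(** * The correspondence between simple objects *)

Section Main.
Variable C : numClosedFieldType.
Hypothesis Cuncount : ~ countable [set: C].

(** A nonzero subobject pulls back along [iota] to a nonzero submodule, so it contains the image of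
    [iota] and all its fractions. The Casimir scalar of [V] passes to fractions. *)
Theorem rationalization_RC_simple (V : lmodType C) (rho : sl2mod V)
    (M : lmodType (ratfun C)) (sigma : ratmod M) (iota : V -> M) :
  simple_mod rho -> torsion_free rho -> rationalization rho sigma iota -> RC_simple sigma.
Proof.
move=> simpV tfV rat.
have [[iD iZ i0 isurj] ia ic] := rationalization_localization tfV rat.
have [mu muE] := simple_cas_scalar Cuncount simpV.
have iN v : iota (- v) = - iota v.
  by rewrite -(scaleN1r (v : zmod rho)) iZ /frc tofracN tofrac1 scaleN1r.
have i00 : iota 0 = 0 by apply: (addrI (iota 0)); rewrite -iD !addr0.
have [[v0 nz0] simp] := simpV.
split; first exists mu => m.
  rewrite casimir_opE; have [v [p [nzp ->]]] := isurj m.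
  rewrite cas_fracZ /cscale scalerA mulrC -scalerA; congr (_ *: _).
  by rewrite -[RHS]iZ -muE /cas iD iN iZ iD iN iZ ia ic.
split; first by exists (iota v0); apply: contra_neq nz0 => /i0.
move=> P [P0 PD PZ [Pa Pb Pc]] _ [m Pm nzm] m'.
have Pi v : P (iota v).
  apply: (simp (fun v => P (iota v))); last first.
    have [v1 [p [nzp mE]]] := isurj m; exists v1; last first.
      by apply: contra_neq nzm => v10; rewrite mE v10 i00 scaler0.
    have -> : iota v1 = frc p *: m by rewrite mE scalerA mulfV ?frc_eq0 ?scale1r.
    exact: PZ.
  split.
  - by rewrite i00.
  - by move=> u w Pu Pw; rewrite iD; exact: PD.
  - by move=> k u Pu; rewrite -(polymodC (L0 rho)) iZ; exact: PZ.
  split=> u Pu.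
  - by rewrite ia; exact: Pa.
  - by rewrite -(polymodX (L0 rho)) iZ; exact: PZ.
  - by rewrite ic; exact: Pc.
by have [v [p [nzp ->]]] := isurj m'; apply: PZ.
Qed.

(** Subobjects of a Casimir module are Casimir with the same scalar, so both notions test the same
    subobjects. *)
Theorem R_simple_RC_simple (M : lmodType (ratfun C)) (sigma : ratmod M) :
  R_simple sigma <-> RC_simple sigma.
Proof.
split=> [simp|[[mu muE] [nz simp]]].
  have [nz min] := simp; split; first exact: R_simple_casimir.
  by split=> // P sP _; exact: min.
by split=> // P sP; apply: simp => //; exists mu => m _; exact: muE.
Qed.

(** The module is the intersection of all nonzero submodules of [N]; by density [N], with its action
    [tau], is its rationalization. *)
Theorem RC_simple_surjective (N : lmodType (ratfun C)) (tau : ratmod N) :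
  RC_simple tau ->
  exists (V : lmodType C) (rho : sl2mod V) (iota : V -> N),
    [/\ simple_mod rho, torsion_free rho & rationalization rho tau iota].
Proof.
move=> RCt; have [w nzw soc] := rat_socle RCt.
have ac := ratmod_semilinear tau; have [aD cD aZ cZ r1] := ac.
pose P v := forall Q : zrat N -> Prop, zstable (W := zrat N) (Qm1 tau) (Q1 tau) Q ->
  (exists2 v, Q v & v != 0) -> Q v.
have Pst : zstable (W := zrat N) (Qm1 tau) (Q1 tau) P.
  split.
  - by move=> Q [].
  - by move=> u v Pu Pv Q sQ nzQ; have [_ QD _ _ _] := sQ; apply: QD; [exact: Pu|exact: Pv].
  - by move=> p u Pu Q sQ nzQ; have [_ _ QZ _ _] := sQ; apply: QZ; exact: Pu.
  - by move=> u Pu Q sQ nzQ; have [_ _ _ Qa _] := sQ; apply: Qa; exact: Pu.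
  - by move=> u Pu Q sQ nzQ; have [_ _ _ _ Qc] := sQ; apply: Qc; exact: Pu.
have Pw : P w by move=> Q; exact: soc.
have [P0 PD PZ Pa Pc] := Pst.
have [V [j [jl jinj jP]]] := @subspace_lmod C (crat N) P P0
  (fun k u v Pu Pv => PD _ _ (PZ k%:P u Pu) Pv).
have Pj v : P (j v) by apply: (jP _).2; exists v.
have jD : {morph (j : V -> zrat N) : u v / u + v}.
  by move=> u v; have := jl 1 u v; rewrite !scale1r.
have j00 : j 0 = 0 by apply: (addrI (j 0)); rewrite -jD !addr0.
have jZ k u : j (k *: u) = k%:P *: (j u : zrat N).
  by have := jl k u 0; rewrite !addr0 j00 addr0.
have lift (f : zrat N -> zrat N) (s : C) : (forall u, P u -> P (f u)) ->
    {morph f : u v / u + v} -> (forall p u, f (p *: u) = shift s p *: f u) ->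
    exists2 g : V -> V, Clinear g & forall v, j (g v) = f (j v).
  move=> Pf fD fZ; have ex v : exists u : V, j u = f (j v) := (jP _).1 (Pf _ (Pj v)).
  pose g v := projT1 (cid (ex v)).
  have gE v : j (g v) = f (j v) by exact: projT2 (cid (ex v)).
  by exists g => // k u v; apply: jinj; rewrite gE jD jZ jD jZ !gE fD fZ shiftC.
have [A Al jA] := lift _ _ Pa aD aZ.
have [B Bl jB] := lift _ _ Pc cD cZ.
have [X Xl jX] : exists2 g : V -> V, Clinear g & forall v, j (g v) = 'X *: (j v : zrat N).
  apply: (lift (fun u => 'X *: u) 0); [exact: PZ|exact: scalerDr|].
  by move=> p u; rewrite shift0 !scalerA mulrC.
have jN v : j (- v) = - j v by rewrite -scaleN1r jZ polyCN polyC1 scaleN1r.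
have rel : sl2_brackets A X B.
  have aX u : Qm1 tau ('X *: (u : zrat N)) = 'X *: (Qm1 tau u : zrat N) - Qm1 tau u.
    by rewrite aZ shiftX polyC1 scalerBl scale1r.
  have cX u : Q1 tau ('X *: (u : zrat N)) = 'X *: (Q1 tau u : zrat N) + Q1 tau u.
    by rewrite cZ shiftX polyCN polyC1 opprK scalerDl scale1r.
  split=> v; apply: jinj; rewrite jD jN.
  - by rewrite jB jA jA jB r1 !mulr2n jD jX.
  - by rewrite jX !jB jX cX opprD addrA subrr sub0r jN jB.
  - by rewrite jX !jA jX aX subKr.
pose rho := Sl2Mod Al Xl Bl rel.
have jp : forall p v, j (p *: (v : zmod rho)) = p *: (j v : zrat N).
  apply: (linear_from_X (V := zmod rho) (V' := zrat N) (f := j)) => [//|k v|v].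
    by rewrite (polymodC (L0 rho)) jZ.
  by rewrite (polymodX (L0 rho)) /= jX.
have tf : torsion_free rho.
  move=> p v nzp pv; apply: jinj; rewrite j00.
  have : p *: (j v : zrat N) = 0 by rewrite -jp (pv : p *: (v : zmod rho) = 0).
  by move/zrat_torsion_free => [/eqP|//]; rewrite (negPf nzp).
have nzV : exists v : V, v != 0.
  have [v jv] := (jP w).1 Pw; exists v; apply: contra_neq nzw => v0.
  by rewrite -jv v0 j00.
have simp : simple_mod rho.
  apply: zsimple_simple nzV _ => Q [Q0 QD QZ Qa Qc] [u Qu nzu] v.
  suff [u' Qu' /jinj <-] : exists2 u', Q u' & j u' = j v by [].
  (* The image of [Q] in [N] is a nonzero submodule, so it contains the intersection [P]. *)
  apply: (Pj v (fun x => exists2 u, Q u & j u = x)); last first.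
    exists (j u); first by exists u.
    by apply: contra_neq nzu => ju; apply: jinj; rewrite ju j00.
  split.
  - by exists 0.
  - by move=> _ _ [x Qx <-] [y Qy <-]; exists (x + y); [exact: QD | rewrite jD].
  - by move=> p _ [x Qx <-]; exists (p *: (x : zmod rho)); [exact: QZ | rewrite jp].
  - by move=> _ [x Qx <-]; exists (A x); [exact: Qa | rewrite jA].
  - by move=> _ [x Qx <-]; exists (B x); [exact: Qc | rewrite jB].
exists V, rho, j; split=> //; apply: localization_rationalization => //.
split=> // [v jv|m]; first by apply: jinj; rewrite jv j00.
have [g nzg Pg] := rat_dense RCt Pst (ex_intro2 _ _ w Pw nzw) m.
have [v jv] := (jP _).1 Pg; exists v, g; split=> //.
by rewrite jv zratE scalerA mulVf ?frc_eq0 ?scale1r.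
Qed.

(** * Isomorphism classes *)

Section Isomorphism.
Variables (V W : lmodType C) (rho : sl2mod V) (rho' : sl2mod W)
  (M N : lmodType (ratfun C)) (sigma : ratmod M) (sigma' : ratmod N)
  (iota : V -> M) (iota' : W -> N).
Hypotheses (tfV : torsion_free rho) (tfW : torsion_free rho')
  (ratV : rationalization rho sigma iota) (ratW : rationalization rho' sigma' iota').

Lemma sl2_iso_rat_iso : sl2_iso rho rho' -> rat_iso sigma sigma'.
Proof.
move=> [f [fl [f' fK f'K] [fa fb fc]]].
have [locV ia ic] := rationalization_localization tfV ratV.
have [locW i'a i'c] := rationalization_localization tfW ratW.
have fD : {morph f : u v / u + v} by move=> u v; have := fl 1 u v; rewrite !scale1r.
have f0 : f 0 = 0 by apply: (addrI (f 0)); rewrite -fD !addr0.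
have fp : forall (p : {poly C}) (v : zmod rho), f (p *: v) = p *: (f v : zmod rho').
  apply: (linear_from_X (V := zmod rho) (V' := zmod rho') (f := f)) => // [k v|v];
    last by rewrite !(polymodX (L0 _)) /= fb.
  by rewrite !(polymodC (L0 _)); have := fl k v 0; rewrite !addr0 f0 addr0.
have f'D : {morph f' : u v / u + v}.
  by move=> u v; rewrite -{1}(f'K u) -{1}(f'K v) -fD fK.
have f'p (p : {poly C}) (v : zmod rho') : f' (p *: v) = p *: (f' v : zmod rho).
  by rewrite -{1}(f'K v) -fp fK.
have [F [FD FE]] := localization_extend (tau := idfun) locV locW (fun=> erefl) fD fp.
have [G [GD GE]] := localization_extend (tau := idfun) locW locV (fun=> erefl) f'D f'p.
have [iD iZ i0 isurj] := locV; have [i'D i'Z i'0 i'surj] := locW.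
have FZ q m : F (frc q *: m) = frc q *: F m.
  have [v [p [nzp ->]]] := isurj m.
  by rewrite scalerA mulrC -scalerA -iZ !FE // fp i'Z !scalerA mulrC.
have [_ _ aZ cZ _] := ratmod_semilinear sigma.
have [_ _ aZ' cZ' _] := ratmod_semilinear sigma'.
exists F; split.
- by move=> k u w; rewrite FD /cscale FZ.
- exists G => m.
    by have [v [p [nzp ->]]] := isurj m; rewrite FE // GE // fK.
  by have [v [p [nzp ->]]] := i'surj m; rewrite GE // FE // f'K.
split=> m.
- have [v [p [nzp ->]]] := isurj m.
  rewrite FE //= (semilinear_inv _ nzp aZ) (semilinear_inv _ nzp aZ') -ia -i'a.
  by rewrite FE ?shift_eq0 //= fa.
- by rewrite !Q0_z FZ.
- have [v [p [nzp ->]]] := isurj m.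
  rewrite FE //= (semilinear_inv _ nzp cZ) (semilinear_inv _ nzp cZ') -ic -i'c.
  by rewrite FE ?shift_eq0 //= fc.
Qed.

(* Both [g (iota V)] and [iota' W] are simple submodules of [N]; they meet
   because [N] is the localization of the second, so they coincide. *)
Lemma rat_iso_sl2_iso : simple_mod rho -> simple_mod rho' ->
  rat_iso sigma sigma' -> sl2_iso rho rho'.
Proof.
move=> simpV simpW [g [gl gbij [ga gb gc]]].
have ginj := bij_inj gbij.
have [[iD iZ i0 isurj] ia ic] := rationalization_localization tfV ratV.
have [[i'D i'Z i'0 i'surj] i'a i'c] := rationalization_localization tfW ratW.
have gD := Clinear_ratD gl; have g0 := Clinear_rat0 gl.
have gp : forall (p : {poly C}) (m : zrat M), g (p *: m) = p *: (g m : zrat N).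
  apply: (linear_from_X (V := zrat M) (V' := zrat N) (f := g)) => // [k v|v].
    exact: (Clinear_ratZ gl).
  by rewrite !zratE -(Q0_z sigma) gb Q0_z.
have i00 : iota 0 = 0 by apply: (addrI (iota 0)); rewrite -iD !addr0.
have i'00 : iota' 0 = 0 by apply: (addrI (iota' 0)); rewrite -i'D !addr0.
have i'N w : iota' (- w) = - iota' w.
  by rewrite -(scaleN1r (w : zmod rho')) i'Z /frc tofracN tofrac1 scaleN1r.
have i'inj : injective iota'.
  move=> u v E; apply/eqP; rewrite -subr_eq0; apply/eqP/i'0.
  by rewrite i'D i'N E subrr.
have [v0 [w0 [nzv0 nzw0 E0]]] : exists v w, [/\ v != 0, w != 0 & g (iota v) = iota' w].
  have [[v nzv] _] := simpV; have [w [p [nzp E]]] := i'surj (g (iota v)).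
  (* Clearing the denominator of [g (iota v)] gives a nonzero vector common to both images. *)
  exists (p *: (v : zmod rho)), w.
  have Ew : g (iota (p *: (v : zmod rho))) = iota' w.
    by rewrite iZ [LHS]gp zratE E scalerA mulfV ?frc_eq0 ?scale1r.
  have nzpv : p *: (v : zmod rho) != 0.
    apply: contra_neq nzv => /(torsion_freeE tfV)[/eqP|//].
    by rewrite (negPf nzp).
  split=> //; apply: contra_neq nzpv => w0; apply/i0/ginj.
  by rewrite Ew w0 i'00 g0.
(* [R] is the graph of the isomorphism: its domain and range are nonzero submodules, hence
   everything, and injectivity of [iota], [iota'] and [g] makes it one-to-one. *)
pose R v w := g (iota v) = iota' w.
have R0 : R 0 0 by rewrite /R i00 g0 i'00.
have RD u v u' v' : R u u' -> R v v' -> R (u + v) (u' + v').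
  by move=> Ru Rv; rewrite /R iD gD Ru Rv i'D.
have RZ (p : {poly C}) (u : zmod rho) (u' : zmod rho') : R u u' -> R (p *: u) (p *: u').
  by move=> Ru; rewrite /R iZ [LHS]gp Ru i'Z.
have Ra u u' : R u u' -> R (Lm1 rho u) (Lm1 rho' u').
  by move=> Ru; rewrite /R ia ga Ru i'a.
have Rc u u' : R u u' -> R (L1 rho u) (L1 rho' u').
  by move=> Ru; rewrite /R ic gc Ru i'c.
have totV v : exists w, R v w.
  apply: (simple_zsimple simpV (P := fun v => exists w, R v w)); last first.
    by exists v0 => //; exists w0.
  split.
  - by exists 0.
  - by move=> u x [u' Ru] [x' Rx]; exists (u' + x'); exact: RD.
  - by move=> p u [u' Ru]; exists (p *: (u' : zmod rho')); exact: RZ.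
  - by move=> u [u' Ru]; exists (Lm1 rho' u'); exact: Ra.
  - by move=> u [u' Ru]; exists (L1 rho' u'); exact: Rc.
have totW w : exists v, R v w.
  apply: (simple_zsimple simpW (P := fun w => exists v, R v w)); last first.
    by exists w0 => //; exists v0.
  split.
  - by exists 0.
  - by move=> u x [u' Ru] [x' Rx]; exists (u' + x'); exact: RD.
  - by move=> p u [u' Ru]; exists (p *: (u' : zmod rho)); exact: RZ.
  - by move=> u [u' Ru]; exists (Lm1 rho u'); exact: Ra.
  - by move=> u [u' Ru]; exists (L1 rho u'); exact: Rc.
have Rfun v w w' : R v w -> R v w' -> w = w'.
  by move=> Rw Rw'; apply: i'inj; rewrite -Rw -Rw'.
have Rinj v v' w : R v w -> R v' w -> v = v'.
  move=> Rv Rv'; have E : iota v = iota v' by apply: ginj; rewrite Rv Rv'.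
  apply/eqP; rewrite -subr_eq0; apply/eqP/i0.
  by rewrite iD -(scaleN1r (v' : zmod rho)) iZ /frc tofracN tofrac1 scaleN1r E subrr.
pose f v := projT1 (cid (totV v)); pose f' w := projT1 (cid (totW w)).
have fR v : R v (f v) by exact: projT2 (cid (totV v)).
have f'R w : R (f' w) w by exact: projT2 (cid (totW w)).
exists f; split.
- move=> k u v; apply: (Rfun (k *: u + v)) => //; apply: RD => //.
  by rewrite -(polymodC (L0 rho)) -(polymodC (L0 rho')); exact: RZ.
- exists f' => [v|w]; first by apply: (Rinj _ _ (f v)).
  by apply: (Rfun (f' w)).
split=> v.
- by apply: (Rfun (Lm1 rho v)) => //; exact: Ra.
- apply: (Rfun (L0 rho v)) => //.
  by rewrite -(polymodX (L0 rho)) -(polymodX (L0 rho')); exact: RZ.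
- by apply: (Rfun (L1 rho v)) => //; exact: Rc.
Qed.
End Isomorphism.
End Main.

(** * Uncountability of the complex numbers, and conclusion *)

Lemma real_uncountable (R : realType) (f : R -> nat) : ~ injective f.
Proof.
move=> finj; have : countable [set: R] by apply/countable_injP; exists f; apply: in2W.
move=> cR; have : countable (`[0, 1]%classic : set R).
  by apply: (sub_countable _ cR); apply: subset_card_le.
(* A countable set has Lebesgue measure 0, while the unit interval has measure 1. *)
move/countable_lebesgue_measure0; rewrite lebesgue_measure_itv /= lte_fin ltr01.
by rewrite -EFinD subr0 => -[]/eqP; rewrite oner_eq0.
Qed.

Lemma complex_uncountable (R : realType) : ~ countable [set: R[i]].
Proof.
move=> /countable_injP[f finj]; apply: (@real_uncountable R (fun x => f x%:C%C)).
by move=> x y /finj; rewrite !inE => /(_ I I) [].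
Qed.

Theorem theorem6p13 (R : realType) :
  (* every simple torsion free sl(2)-module has finite rank *)
  (forall (V : lmodType R[i]) (rho : sl2mod V),
      simple_mod rho -> torsion_free rho -> finite_rank rho) /\
  (* F_rat is defined on simple torsion free modules *)
  (forall (V : lmodType R[i]) (rho : sl2mod V),
      simple_mod rho -> torsion_free rho ->
      exists (M : lmodType (ratfun R[i])) (sigma : ratmod M) (iota : V -> M),
        rationalization rho sigma iota) /\
  (* F_rat sends simple torsion free modules to RC-simple objects *)
  (forall (V : lmodType R[i]) (rho : sl2mod V)
          (M : lmodType (ratfun R[i])) (sigma : ratmod M) (iota : V -> M),
      simple_mod rho -> torsion_free rho -> rationalization rho sigma iota ->
      RC_simple sigma) /\
  (* the induced map on isomorphism classes is well defined and injective *)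
  (forall (V W : lmodType R[i]) (rho : sl2mod V) (rho' : sl2mod W)
          (M N : lmodType (ratfun R[i])) (sigma : ratmod M) (sigma' : ratmod N)
          (iota : V -> M) (iota' : W -> N),
      simple_mod rho -> torsion_free rho -> simple_mod rho' -> torsion_free rho' ->
      rationalization rho sigma iota -> rationalization rho' sigma' iota' ->
      (sl2_iso rho rho' <-> rat_iso sigma sigma')) /\
  (* ... and surjective onto the RC-simple objects *)
  (forall (N : lmodType (ratfun R[i])) (tau : ratmod N),
      RC_simple tau ->
      exists (V : lmodType R[i]) (rho : sl2mod V)
             (M : lmodType (ratfun R[i])) (sigma : ratmod M) (iota : V -> M),
        [/\ simple_mod rho, torsion_free rho, rationalization rho sigma iota &
            rat_iso sigma tau]) /\
  (* the RC-simple objects of RC are exactly the R-simple objects of R;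
     in particular every R-simple rational module is Casimir *)
  (forall (M : lmodType (ratfun R[i])) (sigma : ratmod M),
      R_simple sigma <-> RC_simple sigma).
Proof.
have unc := @complex_uncountable R.
split; first by move=> V rho; exact: simple_finite_rank.
split; first by move=> V rho; exact: simple_rationalization.
split; first by move=> V rho M sigma iota; exact: rationalization_RC_simple.
split.
  move=> V W rho rho' M N sigma sigma' iota iota' sV tV sW tW rV rW.
  by split; [exact: sl2_iso_rat_iso rV rW | exact: rat_iso_sl2_iso rV rW sV sW].
split; last by move=> M sigma; exact: R_simple_RC_simple.
move=> N tau /RC_simple_surjective[V [rho [iota [sV tV rat]]]].
exists V, rho, N, tau, iota; split=> //.
by exists id; split=> //; exists id.
Qed.
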